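(* Let $k$ be a field of characteristic different from $2,3$, and let $\mathcal{C}_{rst}$ be the curve over $k(r,s,t)$ and $\psi_0$ the birational transformation of $(r,s,t)$-space defined in the context. The following transformations $$\begin{aligned} \psi_1(r,s,t)&=\Bigl(\frac{t}{r^2},\ \frac{r^3s}{t},\ \frac{t^2}{r^3}\Bigr),\\ \psi_2(r,s,t)&=\Bigl(r,\ \frac{1}{s(r^3-3rt+t^2+t)},\ t\Bigr),\\ \psi_3(r,s,t)&=\Bigl(r,\ \frac{t(st+1)}{r^3},\ \frac{r^3s}{st+1}\Bigr), \end{aligned}$$ have the property that, for each $i=1,2,3$, if $(r',s',t')=\psi_i(r,s,t)$ then $\mathcal{C}_{r's't'}$ is birationally equivalent to $\mathcal{C}_{rst}$. The group generated by $\psi_1,\psi_2,\psi_3$ (under composition of birational maps) is isomorphic to $\operatorname{PGL}_2(\mathbb{F}_3)$. Furthermore, the group generated by $\psi_0,\psi_1,\psi_2,\psi_3$ is isomorphic to $\mathbb{Z}/2\times\operatorname{PGL}_2(\mathbb{F}_3)$.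
   Context: The curve is $$\mathcal{C}_{rst}\colon y^2=\big((s-st-1)x^3+3s(r-t)x^2+3sr(r-t)x-st^2+sr^3+t\big)^2+4s(x^2+rx+t)^3,$$ a genus $2$ curve over $k(r,s,t)$; birational equivalence is over $k(r,s,t)$. Further, $$\psi_0(r,s,t)=\Bigl(\frac{-s(r-1)(r^2-t)(\delta_5-r)}{(rs-st-1)^2\delta_4},\ \frac{(rs-st-1)^3\delta_4^2}{st(r-1)^3\Delta},\ \frac{s^2(r-1)^3(r^2-t)^3}{(rs-st-1)^3\delta_4^2}\Bigr),$$ where $\delta_4=r^3-3rt+t^2+t$, $\delta_5=r^3s-3rst+st^2+st+t$ and $$\begin{aligned} \Delta={}&r^6s^2-6r^4s^2t-3r^4s+2r^3s^2t^2+2r^3s^2t+3r^3st+r^3s+r^3+9r^2s^2t^2+6r^2st\\ &-6rs^2t^3-6rs^2t^2-9rst^2-3rst-3rt+s^2t^4+2s^2t^3+s^2t^2+2st^3+3st^2+t^2+t. \end{aligned}$$ *)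

(* Defs.v *)
From mathcomp Require Import all_boot all_order all_algebra all_fingroup.
From mathcomp Require Import center.
From mathcomp Require Export mpoly.

Set Implicit Arguments.
Unset Strict Implicit.
Unset Printing Implicit Defensive.

Import GRing.Theory.
Local Open Scope ring_scope.

Notation ratfun F n := {fraction {mpoly F[n]}}.

Section Substitution.
Variable F : fieldType.

Definition ratfunC m (c : F) : ratfun F m := tofrac (c%:MP_[m]).

Definition psubst n m (p : {mpoly F[n]}) (u : n.-tuple (ratfun F m)) :
    ratfun F m :=
  mmap (ratfunC m) (tnth u) p.

(* The chosen representative of h need not be reduced, so this is meaningful
   only when the components of u are algebraically independent over F (see
   [dominant]); in that case no denominator vanishes at u and the value does
   not depend on the representative. *)
Definition rsubst n m (h : ratfun F n) (u : n.-tuple (ratfun F m)) :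
    ratfun F m :=
  psubst \n_(generic_quotient.repr h) u / psubst \d_(generic_quotient.repr h) u.

End Substitution.

Section BirationalSelfMaps.
Variables (F : fieldType) (n : nat).

(* A rational map from affine n-space to itself, given by its components. *)
Definition ratmap := n.-tuple (ratfun F n).
Implicit Types (u v : ratmap) (S : seq ratmap).

Definition ratmap_id : ratmap := [tuple tofrac 'X_i | i < n].

(* ratmap_comp u v is P |-> u (v P). *)
Definition ratmap_comp u v : ratmap := [tuple rsubst (tnth u i) v | i < n].

Definition dominant u := forall p : {mpoly F[n]}, psubst p u = 0 -> p = 0.

Definition ratmap_inverse u v :=
  [/\ dominant u, dominant v,
      ratmap_comp u v = ratmap_id & ratmap_comp v u = ratmap_id].

Definition birational_map u := exists v, ratmap_inverse u v.

(* The subgroup generated by S in the group of birational self-maps of affine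
   n-space; it is only used for lists S of birational maps. *)
Inductive ratmap_gen S : ratmap -> Prop :=
| ratmap_gen_id : ratmap_gen S ratmap_id
| ratmap_gen_mem u of u \in S : ratmap_gen S u
| ratmap_gen_comp u v of ratmap_gen S u & ratmap_gen S v :
    ratmap_gen S (ratmap_comp u v)
| ratmap_gen_inv u v of ratmap_gen S u & ratmap_inverse u v : ratmap_gen S v.

Definition isomorphic_to_group (H : ratmap -> Prop)
    (gT : finGroupType) (G : {group gT}) :=
  exists phi : gT -> ratmap,
    [/\ {in G &, forall x y, phi (x * y)%g = ratmap_comp (phi x) (phi y)},
        {in G &, injective phi}
      & forall u, H u <-> exists2 x, x \in G & phi x = u].

End BirationalSelfMaps.

(* In this section f and g are irreducible polynomials, standing for the affine
   plane curves f = 0 and g = 0 over L.  An element of the function field of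
   f = 0 is represented by a fraction a / b in L(x, y) with b not divisible by
   f, two such fractions being identified when their difference is
   [null_on f]. *)
Section PlaneCurves.
Variable L : fieldType.
Implicit Types (f g : {mpoly L[2]}) (h : ratfun L 2)
  (u v : 2.-tuple (ratfun L 2)).

Definition mdivides f (p : {mpoly L[2]}) := exists q, p = q * f.

Definition regular_on f h :=
  exists a b, ~ mdivides f b /\ h = tofrac a / tofrac b.

Definition null_on f h :=
  exists a b, [/\ mdivides f a, ~ mdivides f b & h = tofrac a / tofrac b].

Definition curve_ratmap f g u :=
  (forall i, regular_on f (tnth u i)) /\ null_on f (psubst g u).

(* The composite v o u is defined on the curve f = 0 and is the identity.  The
   fraction a / b has to be quantified, since some representatives of the
   components of v may have a denominator vanishing identically along u. *)
Definition curve_comp_id f u v :=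
  forall i : 'I_2, exists a b : {mpoly L[2]},
    [/\ tnth v i = tofrac a / tofrac b,
        ~ null_on f (psubst b u)
      & null_on f (psubst a u / psubst b u - tofrac 'X_i)].

Definition birationally_equivalent f g :=
  exists u v, [/\ curve_ratmap f g u, curve_ratmap g f v,
                  curve_comp_id f u v & curve_comp_id g v u].

End PlaneCurves.

Section Family.
Variable L : fieldType.
Implicit Type P : 3.-tuple L.

(* The curve C_rst for (r, s, t) = P, as a polynomial in x = 'X_0, y = 'X_1. *)
Definition curve P : {mpoly L[2]} :=
  let r := tnth P 0 in let s := tnth P 1 in let t := tnth P 2 in
  let x : {mpoly L[2]} := 'X_0 in let y : {mpoly L[2]} := 'X_1 in
  y ^+ 2
  - (((s - s * t - 1) *: x ^+ 3 + (3 * s * (r - t)) *: x ^+ 2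
      + (3 * s * r * (r - t)) *: x + (- s * t ^+ 2 + s * r ^+ 3 + t)%:MP) ^+ 2
     + (4 * s) *: (x ^+ 2 + r *: x + t%:MP) ^+ 3).

Definition delta4 (r t : L) : L := r ^+ 3 - 3 * r * t + t ^+ 2 + t.

Definition delta5 (r s t : L) : L :=
  r ^+ 3 * s - 3 * r * s * t + s * t ^+ 2 + s * t + t.

Definition Delta (r s t : L) : L :=
  r ^+ 6 * s ^+ 2 - 6 * r ^+ 4 * s ^+ 2 * t - 3 * r ^+ 4 * s
  + 2 * r ^+ 3 * s ^+ 2 * t ^+ 2 + 2 * r ^+ 3 * s ^+ 2 * t + 3 * r ^+ 3 * s * t
  + r ^+ 3 * s + r ^+ 3 + 9 * r ^+ 2 * s ^+ 2 * t ^+ 2 + 6 * r ^+ 2 * s * t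
  - 6 * r * s ^+ 2 * t ^+ 3 - 6 * r * s ^+ 2 * t ^+ 2 - 9 * r * s * t ^+ 2
  - 3 * r * s * t - 3 * r * t + s ^+ 2 * t ^+ 4 + 2 * s ^+ 2 * t ^+ 3
  + s ^+ 2 * t ^+ 2 + 2 * s * t ^+ 3 + 3 * s * t ^+ 2 + t ^+ 2 + t.

Definition psi0 P : 3.-tuple L :=
  let r := tnth P 0 in let s := tnth P 1 in let t := tnth P 2 in
  [tuple - s * (r - 1) * (r ^+ 2 - t) * (delta5 r s t - r)
           / ((r * s - s * t - 1) ^+ 2 * delta4 r t);
         (r * s - s * t - 1) ^+ 3 * delta4 r t ^+ 2
           / (s * t * (r - 1) ^+ 3 * Delta r s t);
         s ^+ 2 * (r - 1) ^+ 3 * (r ^+ 2 - t) ^+ 3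
           / ((r * s - s * t - 1) ^+ 3 * delta4 r t ^+ 2)].

Definition psi1 P : 3.-tuple L :=
  let r := tnth P 0 in let s := tnth P 1 in let t := tnth P 2 in
  [tuple t / r ^+ 2; r ^+ 3 * s / t; t ^+ 2 / r ^+ 3].

Definition psi2 P : 3.-tuple L :=
  let r := tnth P 0 in let s := tnth P 1 in let t := tnth P 2 in
  [tuple r; (s * (r ^+ 3 - 3 * r * t + t ^+ 2 + t))^-1; t].

Definition psi3 P : 3.-tuple L :=
  let r := tnth P 0 in let s := tnth P 1 in let t := tnth P 2 in
  [tuple r; t * (s * t + 1) / r ^+ 3; r ^+ 3 * s / (s * t + 1)].

End Family.

Definition PGL2F3 := ('GL_2['F_3] / 'Z('GL_2['F_3]))%G.

(* Main.v *)
(* Put x_i = 1 / rho_i - 1, where rho_0, ..., rho_3 is the orbit of the function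
   r under <psi1, psi2, psi3>.  The x_i embed (r, s, t)-space birationally into
   the quartic prod (1 + x_i) = 1 + sum x_i, that is e_2 + e_3 + e_4 = 0 in the
   elementary symmetric functions, and psi1, psi3, psi2 become the adjacent
   transpositions of the coordinates: they generate a copy of S_4, which is
   PGL_2(F_3) acting on the four points of P^1(F_3).
   If x is on the quartic, then so is c x exactly when
   e_2 + c e_3 + c^2 e_4 = 0; since c = 1 is a root, the other one is
   c = e_2 / e_4, and x |-> (e_2 / e_4) x is an involution commuting with S_4.
   The map psi0 is this involution composed with the permutation (0 2)(1 3).
   The curves are related by x = (a x' + b) / (c x' + d),
   y = e y' / (c x' + d)^3. *)
Require Import Defs.
From mathcomp Require Import all_boot all_order all_algebra all_fingroup.
From mathcomp Require Import generic_quotient center ring.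
From HB Require Import structures.

Set Implicit Arguments.
Unset Strict Implicit.
Unset Printing Implicit Defensive.

Import GRing.Theory.
Local Open Scope ring_scope.

(** * Rational maps and specialization *)

Section FractionRepresentative.
Import FracField.
Local Open Scope quotient_scope.

Lemma fraction_numden (R : idomainType) (h : {fraction R}) :
  h = tofrac \n_(repr h) / tofrac \d_(repr h).
Proof.
have nzd := denom_ratioP (repr h).
rewrite -[LHS]reprK; unlock tofrac.
rewrite -[X in _ = _ * X]pi_inv -[RHS]pi_mul; congr (\pi).
by rewrite /mulf /invf !numden_Ratio ?oner_eq0 // mulr1 mul1r Ratio_numden.
Qed.

End FractionRepresentative.

Section Substitution.
Variables (F : fieldType) (n m : nat).
Implicit Types (p q : {mpoly F[n]}) (h : ratfun F n) (c : ratfun F m).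
Implicit Types (P u v : n.-tuple (ratfun F m)).

HB.instance Definition _ :=
  GRing.RMorphism.copy (@ratfunC F m) (@tofrac _ \o @mpolyC m F).

Lemma psubst0 u : psubst 0 u = 0. Proof. exact: (rmorph0 (mmap _ _)). Qed.
Lemma psubst1 u : psubst 1 u = 1. Proof. exact: (rmorph1 (mmap _ _)). Qed.
Lemma psubstD u p q : psubst (p + q) u = psubst p u + psubst q u.
Proof. exact: (rmorphD (mmap _ _)). Qed.
Lemma psubstN u p : psubst (- p) u = - psubst p u.
Proof. exact: (rmorphN (mmap _ _)). Qed.
Lemma psubstM u p q : psubst (p * q) u = psubst p u * psubst q u.
Proof. exact: (rmorphM (mmap _ _)). Qed.
Lemma psubstX u p k : psubst (p ^+ k) u = psubst p u ^+ k.
Proof. exact: (rmorphXn (mmap _ _)). Qed.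
Lemma psubstC u a : psubst a%:MP u = ratfunC m a.
Proof. exact: mmapC. Qed.
Lemma psubstZ u a p : psubst (a *: p) u = ratfunC m a * psubst p u.
Proof. exact: mmapZ. Qed.
Lemma psubst_var u i : psubst 'X_i u = tnth u i.
Proof. by rewrite /psubst mmapX mmap1U. Qed.

Lemma psubst_nat u k : psubst k%:R u = k%:R.
Proof. exact: (rmorph_nat (mmap _ _)). Qed.

Local Opaque psubst.

Definition psubstE := (psubstD, psubstN, psubstM, psubstX, psubstC, psubstZ,
  psubst_var, psubst_nat, psubst0, psubst1).

(* The rational function h is defined at the point P, with value c. *)
Definition specializes P h c := exists a b,
  [/\ psubst b P != 0, h = tofrac a / tofrac b & c = psubst a P / psubst b P].

Lemma psubst_neq0 P b : psubst b P != 0 -> tofrac b != 0.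
Proof.
by apply: contraNneq => /eqP; rewrite tofrac_eq0 => /eqP->; rewrite psubst0.
Qed.

Lemma specializes_poly P p : specializes P (tofrac p) (psubst p P).
Proof. by exists p, 1; rewrite psubst1 tofrac1 !divr1 oner_neq0. Qed.

(** Cross-multiplying the two fractions gives an identity of polynomials, since [tofrac] is
    injective, and [psubst] preserves that identity. *)
Lemma specializes_fun P h c1 c2 :
  specializes P h c1 -> specializes P h c2 -> c1 = c2.
Proof.
move=> [a1 [b1 [nz1 -> ->]]] [a2 [b2 [nz2 eqh ->]]].
have [nzb1 nzb2] := (psubst_neq0 nz1, psubst_neq0 nz2).
apply/eqP; rewrite (eqr_div _ _ nz1 nz2) -!psubstM; apply/eqP; congr psubst.
apply/eqP; rewrite -tofrac_eq !tofracM -(eqr_div _ _ nzb1 nzb2).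
exact/eqP.
Qed.

Lemma specializesD P h1 h2 c1 c2 : specializes P h1 c1 -> specializes P h2 c2 ->
  specializes P (h1 + h2) (c1 + c2).
Proof.
move=> [a1 [b1 [nz1 -> ->]]] [a2 [b2 [nz2 -> ->]]].
exists (a1 * b2 + a2 * b1), (b1 * b2).
rewrite psubstD !psubstM tofracD !tofracM; split; first exact: mulf_neq0 nz1 nz2.
  by rewrite (addf_div _ _ (psubst_neq0 nz1) (psubst_neq0 nz2)).
by rewrite (addf_div _ _ nz1 nz2).
Qed.

Lemma specializesM P h1 h2 c1 c2 : specializes P h1 c1 -> specializes P h2 c2 ->
  specializes P (h1 * h2) (c1 * c2).
Proof.
move=> [a1 [b1 [nz1 -> ->]]] [a2 [b2 [nz2 -> ->]]].
exists (a1 * a2), (b1 * b2).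
rewrite !psubstM !tofracM !mulf_div.
by split; [exact: mulf_neq0 nz1 nz2 | exact: erefl | exact: erefl].
Qed.

Lemma specializesN P h c : specializes P h c -> specializes P (- h) (- c).
Proof.
move=> [a [b [nz -> ->]]]; exists (- a), b.
by rewrite psubstE tofracN !mulNr.
Qed.

Lemma specializesV P h c : c != 0 -> specializes P h c ->
  specializes P h^-1 c^-1.
Proof.
move=> nzc [a [b [nz -> def_c]]]; exists b, a.
rewrite invf_div def_c invf_div; split; [|exact: erefl|exact: erefl].
by apply: contraNneq nzc => a0; rewrite def_c a0 mul0r.
Qed.

Lemma specializesX P h c k : specializes P h c -> specializes P (h ^+ k) (c ^+ k).
Proof.
move=> hc; elim: k => [|k IHk]; last by rewrite !exprS; apply: specializesM.
by rewrite !expr0 -tofrac1 -(psubst1 P); apply: specializes_poly.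
Qed.

Lemma specializes_nat P k : specializes P k%:R k%:R.
Proof.
by rewrite -(psubst_nat P) -(rmorph_nat (@tofrac _)); apply: specializes_poly.
Qed.

End Substitution.

Section Composition.
Variables (F : fieldType) (n : nat).
Notation ratmap := (ratmap F n).
Implicit Types (u v w : ratmap) (h c : ratfun F n) (p : {mpoly F[n]}).

Lemma psubst_id p : psubst p (ratmap_id F n) = tofrac p.
Proof.
elim/mpolyind: p => [|c m p _ _ IHp]; first by rewrite psubst0 tofrac0.
rewrite psubstD psubstZ IHp tofracD -mul_mpolyC tofracM; congr (_ * _ + _).
rewrite /psubst mmapX /mmap1 mpolyXE_id rmorph_prod.
by apply: eq_bigr => i _; rewrite tnth_mktuple -tofracXn.
Qed.


Lemma specializes_psubst u v w p :
  (forall i, specializes w (tnth u i) (tnth v i)) ->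
  specializes w (psubst p u) (psubst p v).
Proof.
move=> uv; elim/mpolyind: p => [|c m p _ _ IHp].
  by rewrite !psubst0; apply: (specializes_nat _ 0).
rewrite !psubstD !psubstZ; apply/specializesD/IHp/specializesM.
  by rewrite -{2}(psubstC w); apply: specializes_poly.
rewrite /psubst !mmapX /mmap1; elim/big_ind2: _ => [||i _].
- exact: (specializes_nat _ 1).
- by move=> *; apply: specializesM.
- exact: specializesX.
Qed.

Lemma dominant_id : dominant (ratmap_id F n).
Proof. by move=> p /eqP; rewrite psubst_id tofrac_eq0 => /eqP. Qed.

(** If $p(u) = 0$, substituting [w] gives 0 on the one hand and [p] itself on the other. Dominance
    thus follows from a mere specialization statement, before [ratmap_comp] is known to be
    meaningful. *)
Lemma dominant_of_inverse u w :
  (forall i, specializes w (tnth u i) (tnth (ratmap_id F n) i)) -> dominant u.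
Proof.
move=> uw p pu0; apply: dominant_id; apply: (@specializes_fun _ _ _ w 0).
  by rewrite -pu0; apply: specializes_psubst.
exact: (specializes_nat _ 0).
Qed.

(** Dominance keeps the denominator of the chosen representative from vanishing. With
    [specializes_fun], [rsubst] can then be computed from any fraction whose denominator survives
    the substitution. *)
Lemma rsubstP u h : dominant u -> specializes u h (rsubst h u).
Proof.
move=> dom_u; exists \n_(repr h), \d_(repr h); split=> //.
  by apply: contraNneq (denom_ratioP (repr h)) => /dom_u/eqP.
exact: fraction_numden.
Qed.

Lemma specializes_rsubst u h c : dominant u -> specializes u h c -> rsubst h u = c.
Proof. by move=> dom_u; apply/specializes_fun/rsubstP. Qed.

Lemma ratmap_compP u v w : dominant v ->
  (forall i, specializes v (tnth u i) (tnth w i)) -> ratmap_comp u v = w.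
Proof.
move=> dom_v uvw; apply: eq_from_tnth => i; rewrite tnth_mktuple.
exact: specializes_rsubst.
Qed.

Lemma ratmap_comp_idl u : dominant u -> ratmap_comp (ratmap_id F n) u = u.
Proof.
move=> dom_u; apply: ratmap_compP => // i.
by rewrite tnth_mktuple -(psubst_var u); apply: specializes_poly.
Qed.

Lemma ratmap_comp_idr u : ratmap_comp u (ratmap_id F n) = u.
Proof.
apply: ratmap_compP dominant_id _ => i.
have [a [b [nz eqh eqc]]] := rsubstP (tnth u i) dominant_id.
by exists a, b; rewrite nz {1}eqh !psubst_id.
Qed.

Lemma ratmap_compA u v w : dominant v -> dominant w ->
  dominant (ratmap_comp v w) ->
  ratmap_comp u (ratmap_comp v w) = ratmap_comp (ratmap_comp u v) w.
Proof.
move=> dom_v dom_w dom_vw; apply: ratmap_compP => // i; rewrite !tnth_mktuple.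
have [a [b [nz def_h def_c]]] := rsubstP (tnth u i) dom_v.
(* Substituting [w] into $p(v)$ yields $p(v \circ w)$; dominance of the composite then keeps the
   denominator [b] nonzero. *)
have vwP p : specializes w (psubst p v) (psubst p (ratmap_comp v w)).
  by apply: specializes_psubst => j; rewrite tnth_mktuple; apply: rsubstP.
have nzvw : psubst b (ratmap_comp v w) != 0.
  by apply: contraNneq nz => /dom_vw->; rewrite psubst0.
exists a, b; split; [exact: nzvw | exact: def_h |].
apply: specializes_rsubst => //; rewrite def_c.
exact: specializesM (vwP a) (specializesV nzvw (vwP b)).
Qed.

End Composition.

(** * Groups of rational maps parametrized by a finite group *)

Section GroupsOfRatmaps.
Variables (F : fieldType) (n : nat) (gT : finGroupType) (phi : gT -> ratmap F n).
Hypothesis phi_dominant : forall x, dominant (phi x).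
Hypothesis phi1 : phi 1%g = ratmap_id F n.
Hypothesis phiM : forall x y, phi (x * y)%g = ratmap_comp (phi x) (phi y).

Lemma ratmap_inverse_phi x : ratmap_inverse (phi x) (phi x^-1%g).
Proof. by split; rewrite -?phiM ?mulgV ?mulVg. Qed.

(** The usual uniqueness of inverses; associativity applies because [ratmap_inverse] includes the
    dominance of [v]. *)
Lemma ratmap_inverse_phi_uniq x v :
  ratmap_inverse (phi x) v -> v = phi x^-1%g.
Proof.
case=> dom_x dom_v xvK _; rewrite -[LHS]ratmap_comp_idl //.
have [_ _ _ <-] := ratmap_inverse_phi x.
rewrite -ratmap_compA // xvK ?ratmap_comp_idr //; exact: dominant_id.
Qed.

Lemma ratmap_gen_phi (S : seq (ratmap F n)) (s : seq gT) u : S = map phi s ->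
  ratmap_gen S u <-> exists2 x, x \in <<[set x in s]>>%g & phi x = u.
Proof.
move=> defS; split=> [|[x + <-]].
  elim=> {u} [|u|u v _ [x Gx <-] _ [y Gy <-]|u v _ [x Gx <-]].
  - by exists 1%g.
  - by rewrite defS => /mapP[x sx ->]; exists x; rewrite ?mem_gen ?inE.
  - by exists (x * y)%g; rewrite ?groupM.
  by move/ratmap_inverse_phi_uniq->; exists x^-1%g; rewrite ?groupV.
(* In a finite group, a generated subgroup consists of the products of generators, so inverses
   require no separate case. *)
case/gen_prodgP=> k [c sc ->].
elim: k c sc => [|k IHk] c sc; first by rewrite big_ord0 phi1; constructor.
rewrite big_ord_recl phiM; apply: ratmap_gen_comp; last by apply: IHk => i.
by apply: ratmap_gen_mem; rewrite defS map_f //; have:= sc ord0; rewrite inE.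
Qed.

(** Here [f] carries the model group [G] onto the subgroup generated by the parameters [s] of the
    maps in [S], so [phi \o f] is the isomorphism. *)
Lemma isomorphic_to_group_phi (S : seq (ratmap F n)) (s : seq gT)
    (rT : finGroupType) (G : {group rT}) (f : rT -> gT) :
    injective phi -> S = map phi s ->
    {in G &, {morph f : x y / (x * y)%g}} -> {in G &, injective f} ->
    f @: G = <<[set x in s]>>%g ->
  isomorphic_to_group (ratmap_gen S) G.
Proof.
move=> phi_inj defS fM f_inj fG; exists (phi \o f); split=> /= [x y Gx Gy||u].
- by rewrite fM.
- by move=> x y Gx Gy /phi_inj/f_inj; apply.
rewrite (ratmap_gen_phi u defS) -fG; split=> [[_ /imsetP[x Gx ->]]|[x Gx]] <-.
  by exists x.
by exists (f x); rewrite ?imset_f.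
Qed.

End GroupsOfRatmaps.

(** * PGL(2, 3) as a symmetric group *)

Section PGL2F3.
Local Notation F := 'F_3.
Local Notation mx g := (@GLval 2 _ g).
Local Notation vec := 'rV[F]_2.
Implicit Types (v w : vec) (A B : 'M[F]_2) (i j : 'I_4) (e : bool).

(** Representatives of the four points of $\mathbb{P}^1(\mathbb{F}_3)$: $(1,i)$ for $i<3$, and
    $(0,1)$ for the last index. *)
Definition line_vec i : vec :=
  \row_j if i == ord_max then (j == 1)%:R else if j == 0 then 1 else i%:R.

Definition line_of v : 'I_4 :=
  if v 0 0 == 0 then ord_max else inord (v 0 1 / v 0 0)%R.

(** The units of $\mathbb{F}_3$ are $\pm 1$; proportionality of vectors is therefore expressed below
    by a Boolean sign [e]. *)
Lemma F3_sign (a : F) : a != 0 -> exists e, a = (-1) ^+ e.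
Proof.
case: a => [[|[|[|//]]] lt_a] //= _; [exists false | exists true]; exact: val_inj.
Qed.

Lemma line_vec_neq0 i : line_vec i != 0.
Proof.
apply/eqP=> /rowP v0; have := v0 0; have := v0 1; rewrite !mxE /=.
by case: (i == _) => //= _ /eqP; rewrite oner_eq0.
Qed.

Lemma line_vec_inj i j e : line_vec i = (-1) ^+ e *: line_vec j -> i = j.
Proof.
move=> /rowP vij; have := vij 0; have := vij 1; rewrite !mxE /=.
case: eqP => [->|ni]; case: eqP => [->|nj] //=.
- by rewrite mulr1 => _ /eqP; rewrite eq_sym signr_eq0.
- by rewrite mulr0 => _ /eqP; rewrite oner_eq0.
rewrite mulr1 => vij1 sgn; move: vij1; rewrite -sgn mul1r => vij1.
apply/val_inj.
case: i ni vij1 {vij sgn} => [[|[|[|[|//]]]] /= lti] ni;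
  case: j nj => [[|[|[|[|//]]]] /= ltj] nj //;
  by [case: ni; apply: val_inj | case: nj; apply: val_inj].
Qed.

Lemma line_ofP v : v != 0 -> exists e, v = (-1) ^+ e *: line_vec (line_of v).
Proof.
have eq_vec a b : v 0 0 = a -> v 0 1 = b -> v = \row_j if j == 0 then a else b.
  move=> va vb; apply/rowP=> j; rewrite mxE.
  by case: j => [[|[|//]] lt_j] /=; rewrite -?va -?vb; congr (v _ _); apply: val_inj.
move=> nz_v; rewrite /line_of; case: eqP => [v0|/eqP v0].
  have /F3_sign[e v1] : v 0 1 != 0.
    apply: contraNneq nz_v => v1; apply/eqP; rewrite (eq_vec 0 0) //.
    by apply/rowP=> j; rewrite !mxE if_same.
  exists e; rewrite (eq_vec _ _ v0 v1); apply/rowP=> j; rewrite !mxE eqxx.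
  by case: j => [[|[|//]] lt_j] /=; rewrite ?mulr0 ?mulr1.
have [e v0e] := F3_sign v0; exists e; rewrite {1}(eq_vec _ _ v0e erefl).
have def_v1 : v 0 1 = v 0 0 * (v 0 1 / v 0 0) by rewrite mulrC divfK.
move: (v 0 1 / v 0 0) def_v1 => q ->; have lt_q := ltn_ord q.
have q_val : (inord q : 'I_4) = q :> nat by rewrite inordK ?(ltn_trans lt_q).
have not_max : (inord q == ord_max :> 'I_4) = false.
  by rewrite -val_eqE /= q_val ltn_eqF.
apply/rowP=> j; rewrite !mxE not_max q_val -v0e.
by case: eqP => _; rewrite ?mulr1 // natr_Zp.
Qed.


Lemma mulmx_GL_neq0 (g : {'GL_2[F]}) v : v != 0 -> v *m mx g != 0.
Proof.
have unit_g : mx g \in unitmx := GL_unitmx g.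
by apply: contraNneq => vg0; rewrite -(mulmxK unit_g v) vg0 mul0mx.
Qed.

(** Row vectors are multiplied on the right, which agrees with the left-to-right product of
    permutations. *)
Definition line_act (g : {'GL_2[F]}) i := line_of (line_vec i *m mx g).

Lemma line_actP g i : exists e,
  line_vec i *m mx g = (-1) ^+ e *: line_vec (line_act g i).
Proof. exact/line_ofP/mulmx_GL_neq0/line_vec_neq0. Qed.

Lemma line_act_eq g i j e :
  line_vec i *m mx g = (-1) ^+ e *: line_vec j -> line_act g i = j.
Proof.
have [e' ->] := line_actP g i => /(canRL (signrZK _)).
by rewrite scalerA -signr_addb => /line_vec_inj.
Qed.

Lemma line_actM g h i : line_act (g * h)%g i = line_act h (line_act g i).
Proof.
have [[e1 ge] [e2 he]] := (line_actP g i, line_actP h (line_act g i)).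
apply: (@line_act_eq _ _ _ (e1 (+) e2)).
by rewrite GL_ME mulmxA ge -scalemxAl he scalerA -signr_addb.
Qed.

Lemma line_act1 i : line_act 1%g i = i.
Proof. by apply: (@line_act_eq _ _ _ false); rewrite GL_1E mulmx1 scale1r. Qed.

Lemma line_act_inj g : injective (line_act g).
Proof.
by move=> i j /(congr1 (line_act g^-1%g)); rewrite -!line_actM mulgV !line_act1.
Qed.

Definition line_perm g : 'S_4 := perm (@line_act_inj g).

Lemma line_permM : {in 'GL_2[F]%g &, {morph line_perm : g h / (g * h)%g}}.
Proof. by move=> g h _ _; apply/permP=> i; rewrite permM !permE line_actM. Qed.

Canonical line_perm_morphism := Morphism line_permM.

(** The vectors $(1,0)$, $(0,1)$ and their sum $(1,1)$ are all eigenvectors, which forces the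
    eigenvalues to coincide. *)
Lemma scalar_of_line_perm1 g : line_perm g = 1%g -> exists e, mx g = ((-1) ^+ e)%:M.
Proof.
move=> /permP fix_g.
have {fix_g}ev i : exists e, line_vec i *m mx g = (-1) ^+ e *: line_vec i.
  by have [e] := line_actP g i; have:= fix_g i; rewrite permE perm1 => ->; exists e.
have [[e0 v0] [e1 v1] [e3 v3]] := And3 (ev 0) (ev 1) (ev ord_max).
have v10 : line_vec 1 = line_vec 0 + line_vec ord_max.
  by apply/rowP=> j; rewrite !mxE /=; case: j => [[|[|//]] lt_j]; apply: val_inj.
move: v1; rewrite v10 mulmxDl v0 v3 => /rowP v1; exists e1.
have := v1 1; have := v1 0; rewrite !mxE /= !(mulr1, mulr0, addr0, add0r) => e01 e31.
have vecE v : v = v 0 0 *: line_vec 0 + v 0 1 *: line_vec ord_max.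
  apply/rowP=> j; rewrite !mxE /=.
  by case: j => [[|[|//]] lt_j] /=; rewrite ?(mulr1, mulr0, addr0, add0r);
    congr (v _ _); apply: val_inj.
apply/row_matrixP=> i; rewrite !rowE mul_mx_scalar; move: (delta_mx 0 i) => v.
rewrite [v]vecE mulmxDl -!scalemxAl v0 v3 e01 e31.
by rewrite scalerDr !scalerA ![_ * v _ _]mulrC.
Qed.

(** If a central [x] moves [i], choose [k] outside $\{i, x(i)\}$: the transposition of $x(i)$ and
    [k] fixes [i] but moves $x(i)$, so it does not commute with [x]. *)
Lemma center_Sym4 : 'Z([set: 'S_4])%g = 1%g.
Proof.
apply/trivgP/subsetP=> x /centerP[_ cent_x]; apply/set1P/permP=> i; rewrite perm1.
apply/eqP; apply: contraT => xi_neq.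
have [k ki kxi] : exists2 k, k != i & k != x i.
  have /card_gt0P[k] : (0 < #|~: [set i; x i]|)%N.
    by rewrite cardsCs setCK card_ord cards2; case: (_ != _).
  by rewrite !inE negb_or => /andP[]; exists k.
have := cent_x (tperm (x i) k) (in_setT _) => /permP/(_ i).
by rewrite !permM tpermL tpermD // => kx; rewrite kx eqxx in kxi.
Qed.

Local Open Scope group_scope.

Lemma PGL2F3_isog : PGL2F3 \isog [set: 'S_4].
Proof.
have cardS4 : #|[set: 'S_4]| = 24 by rewrite cardsT card_Sn.
pose scalars : {set 'M[F]_2} := [set 1%:M; (-1)%:M]%R.
have ker_scal g : g \in 'ker line_perm -> mx g \in scalars.
  by move=> /mker/scalar_of_line_perm1[[] ->]; rewrite !inE eqxx ?orbT.
have ker_small : (#|'ker line_perm| <= 2)%N.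
  have sub : [set mx g | g in 'ker line_perm] \subset scalars.
    by apply/subsetP=> _ /imsetP[g /ker_scal ? ->].
  rewrite -(card_imset _ (val_inj : injective (fun g => mx g))).
  by apply: leq_trans (subset_leq_card sub) _; rewrite cards2; case: (_ != _).
have ker_center : 'ker line_perm \subset 'Z('GL_2[F]).
  apply/subsetP=> g /ker_scal g_scal.
  apply/centerP; split=> [|h _]; first by rewrite inE.
  apply: val_inj; rewrite ![val _]GL_MxE.
  by case/set2P: g_scal => ->; rewrite scalar_mxC.
(* Counting: $|GL_2(\mathbb{F}_3)| = 48$ and the kernel has at most 2 elements, so the image has at
   least $24 = |S_4|$. *)
have im_full : line_perm @* 'GL_2[F] = [set: 'S_4].
  apply/eqP; rewrite eqEcard subsetT cardS4.
  have := Lagrange (subsetT ('ker line_perm_morphism)%G).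
  rewrite card_GL_2 card_Fp // card_morphim setIid => cardGL.
  rewrite -(@leq_pmul2l 2) // (_ : (2 * 24 = 3 * 2 ^ 2 * 4)%N) // -cardGL.
  by rewrite leq_mul2r ker_small orbT.
(* The kernel is made of scalars, hence central; conversely the center maps into the center of the
   image $S_4$, which is trivial. *)
have center_ker : 'Z('GL_2[F]) = 'ker line_perm.
  apply/eqP; rewrite eqEsubset ker_center andbT.
  apply/subsetP=> g Zg; have [GLg cent_g] := centerP _ _ Zg.
  apply/kerP => //; apply/set1P; have -> : [set 1] = 'Z(line_perm @* 'GL_2[F]).
    by rewrite im_full center_Sym4.
  apply/centerP; split=> [|_ /morphimP[h _ GLh ->]]; first exact: mem_morphim.
  by rewrite /commute -!line_permM // cent_g.
rewrite /PGL2F3 /= center_ker -im_full; exact: first_isog.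
Qed.

End PGL2F3.

(** * The symmetric coordinates *)

Local Notation i0 := (ord0 : 'I_4).
Local Notation i1 := (lift ord0 (ord0 : 'I_3) : 'I_4).
Local Notation i2 := (lift ord0 (lift ord0 (ord0 : 'I_2)) : 'I_4).
Local Notation i3 := (lift ord0 (lift ord0 (lift ord0 (ord0 : 'I_1))) : 'I_4).

Lemma ord4P (P : 'I_4 -> Prop) : P i0 -> P i1 -> P i2 -> P i3 -> forall i, P i.
Proof.
move=> P0 P1 P2 P3 [[|[|[|[|//]]]] lt_i4].
- by rewrite (_ : Ordinal _ = i0); last exact: val_inj.
- by rewrite (_ : Ordinal _ = i1); last exact: val_inj.
- by rewrite (_ : Ordinal _ = i2); last exact: val_inj.
- by rewrite (_ : Ordinal _ = i3); last exact: val_inj.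
Qed.

Section Coordinates.
Variable L : fieldType.
Implicit Types (x y : {ffun 'I_4 -> L}) (P : 3.-tuple L) (g h : 'Z_2 * 'S_4).

(* x_i = 1 / rho_i - 1, with rho_0 = r, rho_1 = t / r^2, rho_2 = r s / (s t + 1)
   and rho_3 = r / (t + s delta4). *)
Definition coords P : {ffun 'I_4 -> L} :=
  let r := tnth P 0 in let s := tnth P 1 in let t := tnth P 2 in
  let c : 4.-tuple L := [tuple (1 - r) / r; (r ^+ 2 - t) / t;
    (s * t + 1 - r * s) / (r * s); (t + s * delta4 r t - r) / r] in
  [ffun i => tnth c i].

(** Obtained by solving the formulas for $\rho_0, \rho_1, \rho_2$ for $r, s, t$, with $q_i =
    1/\rho_i$. *)
Definition point x : 3.-tuple L :=
  let q i := 1 + x i in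
  [tuple (q i0)^-1; q i0 ^+ 2 * q i1 / (q i0 * q i1 * q i2 - 1);
         (q i0 ^+ 2 * q i1)^-1].

(** This is $e_2/e_4$. Writing $2e_2$ with power sums makes the invariance under permutations a mere
    reindexing. *)
Definition ratio x := ((\sum_i x i) ^+ 2 - \sum_i x i ^+ 2) / (2 * \prod_i x i).

Definition permute (s : 'S_4) x : {ffun 'I_4 -> L} := [ffun i => x (s i)].
Definition scale x : {ffun 'I_4 -> L} := [ffun i => ratio x * x i].
Definition act g x := permute g.2 (if g.1 == 0 then x else scale x).

Definition on_quartic x := \prod_i (1 + x i) = 1 + \sum_i x i.

(** An open part of the quartic stable under the whole action. The conditions on $\sum_j x_j - x_i$
    keep $1 + c x_i$ nonzero after scaling by $c = e_2/e_4$, as [scaleE] shows; the last condition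
    makes $c$ nonzero. *)
Definition admissible x :=
  [/\ on_quartic x, forall i, x i != 0, forall i, 1 + x i != 0,
      forall i, \sum_j x j - x i != 0
    & (\sum_i x i) ^+ 2 - \sum_i x i ^+ 2 != 0].

Lemma sum4 (f : 'I_4 -> L) : \sum_i f i = f i0 + f i1 + f i2 + f i3.
Proof. by rewrite !big_ord_recl big_ord0 addr0 !addrA. Qed.

Lemma prod4 (f : 'I_4 -> L) : \prod_i f i = f i0 * f i1 * f i2 * f i3.
Proof. by rewrite !big_ord_recl big_ord0 mulr1 !mulrA. Qed.

Hypothesis two_neq0 : 2 != 0 :> L.

Lemma ratio_neq0 x : admissible x -> ratio x != 0.
Proof.
case=> _ nzx _ _ nze2; rewrite mulf_neq0 ?invr_neq0 // mulf_neq0 //.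
by apply/prodf_neq0.
Qed.

Lemma sum_permute s (f : L -> L) x : \sum_i f (permute s x i) = \sum_i f (x i).
Proof.
rewrite [RHS](reindex_inj (@perm_inj _ s)).
by apply: eq_bigr => i _; rewrite ffunE.
Qed.

Lemma prod_permute s (f : L -> L) x : \prod_i f (permute s x i) = \prod_i f (x i).
Proof.
rewrite [RHS](reindex_inj (@perm_inj _ s)).
by apply: eq_bigr => i _; rewrite ffunE.
Qed.

Lemma ratio_permute s x : ratio (permute s x) = ratio x.
Proof.
by rewrite /ratio (sum_permute _ id) (sum_permute _ (fun a => a ^+ 2))
  (prod_permute _ id).
Qed.

Lemma admissible_permute s x : admissible x -> admissible (permute s x).
Proof.
rewrite /admissible /on_quartic (prod_permute _ (fun a => 1 + a)).
rewrite (sum_permute _ id) (sum_permute _ (fun a => a ^+ 2)).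
by case=> eqx nzx nzq nzS nze2; split=> // i; rewrite ffunE.
Qed.

Lemma quartic_e2 x : on_quartic x ->
  (\sum_i x i) ^+ 2 - \sum_i x i ^+ 2 =
  - 2 * (x i0 * x i1 * x i2 + x i0 * x i1 * x i3 + x i0 * x i2 * x i3
         + x i1 * x i2 * x i3 + \prod_i x i).
Proof.
rewrite /on_quartic !sum4 !prod4 => eqx.
apply/eqP; rewrite -subr_eq0 -[X in _ == X](mulr0 2); apply/eqP.
have /eqP := eqx; rewrite -subr_eq0 => /eqP <-; ring.
Qed.

(** The difference of the two sides is a multiple of the equation of the quartic. The factored form
    shows that $1 + c x_i$ does not vanish and keeps the later computation of [psi0] small. *)
Lemma scaleE x i : admissible x ->
  1 + scale x i = x i ^+ 3 * (\sum_j x j - x i) / ((1 + x i) * \prod_j x j).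
Proof.
case=> eqx nzx nzq _ _; apply/eqP; rewrite -subr_eq0 ffunE /ratio quartic_e2 //.
suff -> : 1 + - 2 * (x i0 * x i1 * x i2 + x i0 * x i1 * x i3 + x i0 * x i2 * x i3
         + x i1 * x i2 * x i3 + \prod_i x i) / (2 * \prod_i x i) * x i
   - x i ^+ 3 * (\sum_j x j - x i) / ((1 + x i) * \prod_j x j)
   = - x i ^+ 2 * (\prod_j (1 + x j) - (1 + \sum_j x j))
      / ((1 + x i) * \prod_j x j).
  by rewrite eqx subrr mulr0 mul0r.
have [nz0 nz1 nz2 nz3] := And4 (nzx i0) (nzx i1) (nzx i2) (nzx i3).
have := nzq i; rewrite !sum4 !prod4.
by elim/ord4P: i => nzqi; field; rewrite nz0 nz1 nz2 nz3 nzqi two_neq0.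
Qed.

Lemma ratioE x : admissible x -> ratio x =
  - (x i0 * x i1 * x i2 + x i0 * x i1 * x i3 + x i0 * x i2 * x i3
         + x i1 * x i2 * x i3 + \prod_i x i) / \prod_i x i.
Proof.
case=> eqx nzx _ _ _; rewrite /ratio quartic_e2 // mulNr -mulrN -mulf_div divff //.
by rewrite mul1r.
Qed.

Lemma scaled_quartic (a b c d k : L) :
  (1 + a) * (1 + b) * (1 + c) * (1 + d) = 1 + (a + b + c + d) ->
  k * (a * b * c * d) =
    - (a * b * c + a * b * d + a * c * d + b * c * d + a * b * c * d) ->
  (1 + k * a) * (1 + k * b) * (1 + k * c) * (1 + k * d) =
    1 + (k * a + k * b + k * c + k * d).
Proof.
move=> /eqP; rewrite -subr_eq0 => /eqP eq1 /eqP; rewrite -addr_eq0 => /eqP eq2.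
apply/eqP; rewrite -subr_eq0; apply/eqP.
(* The difference of the sides is $k^2 e_2 + k^3 e_3 + k^4 e_4 = k^2(e_2+e_3+e_4) +
   k^2(k-1)(e_3+e_4+k e_4)$, and both brackets vanish. *)
transitivity (k ^+ 2 * 0 + k ^+ 2 * (k - 1) * 0).
  by rewrite -{1}eq1 -eq2; ring.
by rewrite !mulr0 addr0.
Qed.

Lemma on_quartic_scale x : admissible x -> on_quartic (scale x).
Proof.
move=> adm_x; have [eqx nzx _ _ _] := adm_x.
have nzp : \prod_i x i != 0 by apply/prodf_neq0.
rewrite /on_quartic !sum4 !prod4 !ffunE; apply: scaled_quartic.
  by rewrite -(prod4 (fun i => 1 + x i)) -sum4.
by rewrite -prod4 ratioE // divfK.
Qed.

Lemma sum_scale x : \sum_i scale x i = ratio x * \sum_i x i.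
Proof. by rewrite mulr_sumr; apply: eq_bigr => i _; rewrite ffunE. Qed.

Lemma e2_scale x : (\sum_i scale x i) ^+ 2 - \sum_i scale x i ^+ 2 =
  ratio x ^+ 2 * ((\sum_i x i) ^+ 2 - \sum_i x i ^+ 2).
Proof.
rewrite sum_scale mulrBr -exprMn; congr (_ - _).
by rewrite mulr_sumr; apply: eq_bigr => i _; rewrite ffunE exprMn.
Qed.

Lemma admissible_scale x : admissible x -> admissible (scale x).
Proof.
move=> adm_x; have [_ nzx nzq nzS nze2] := adm_x; have nzc := ratio_neq0 adm_x.
have nzp : \prod_i x i != 0 by apply/prodf_neq0.
split=> [|i|i|i|]; first exact: on_quartic_scale.
- by rewrite ffunE mulf_neq0.
- by rewrite scaleE // mulf_neq0 ?invr_neq0 ?mulf_neq0 ?expf_neq0.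
- by rewrite sum_scale ffunE -mulrBr mulf_neq0.
- by rewrite e2_scale mulf_neq0 ?expf_neq0.
Qed.

(** Scaling by $c$ multiplies $e_2$ by $c^2$ and $e_4$ by $c^4$, hence $c = e_2/e_4$ becomes $c
    \cdot c^{-2}$. *)
Lemma ratio_scale x : admissible x -> ratio (scale x) = (ratio x)^-1.
Proof.
move=> adm_x; have [_ nzx _ _ _] := adm_x; have nzc := ratio_neq0 adm_x.
have nzp : \prod_i x i != 0 by apply/prodf_neq0.
have prod_scale : \prod_i scale x i = ratio x ^+ 4 * \prod_i x i.
  by rewrite !prod4 !ffunE; ring.
rewrite {1}/ratio e2_scale prod_scale.
have -> : (\sum_i x i) ^+ 2 - \sum_i x i ^+ 2 = ratio x * (2 * \prod_i x i).
  by rewrite [RHS]mulrC mulrC divfK // mulf_neq0.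
by field; rewrite two_neq0 nzc nzp.
Qed.

Lemma scaleK x : admissible x -> scale (scale x) = x.
Proof.
move=> adm_x; apply/ffunP=> i; rewrite ffunE ratio_scale // ffunE mulrA mulVf ?mul1r //.
exact: ratio_neq0.
Qed.

Lemma permuteE s x i : permute s x i = x (s i).
Proof. exact: ffunE. Qed.

Lemma scale_permute s x : scale (permute s x) = permute s (scale x).
Proof. by apply/ffunP=> i; rewrite !ffunE ratio_permute. Qed.

(** Since products in ['S_4] are read from left to right, precomposition is a left action. *)
Lemma permuteM s1 s2 x : permute s1 (permute s2 x) = permute (s1 * s2)%g x.
Proof. by apply/ffunP=> i; rewrite !ffunE permM. Qed.

Lemma admissible_act g x : admissible x -> admissible (act g x).
Proof.
by move=> adm_x; apply: admissible_permute; case: ifP => // _; apply: admissible_scale.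
Qed.

Lemma act1 x : act 1%g x = x.
Proof. by apply/ffunP=> i; rewrite /act eqxx ffunE perm1. Qed.

Lemma actM g h x : admissible x -> act g (act h x) = act (g * h)%g x.
Proof.
case: g h => [e1 s1] [e2 s2] adm_x; rewrite /act /=.
case: e1 e2 => [[|[|//]] lt1] [[|[|//]] lt2] /=;
  rewrite ?scale_permute ?scaleK ?permuteM //.
Qed.

(** If the product of the first three factors were 1, the quartic would read $1 + x_3 = 1 + \sum_i
    x_i$, against the condition on $\sum_j x_j - x_3$. *)
Lemma admissible_denom x : admissible x ->
  (1 + x i0) * (1 + x i1) * (1 + x i2) - 1 != 0.
Proof.
case=> + _ _ /(_ i3) + _; rewrite /on_quartic sum4 prod4 => eqx nzT.
apply: contraNneq nzT => D0.
have -> : x i0 + x i1 + x i2 + x i3 - x i3 =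
    1 + (x i0 + x i1 + x i2 + x i3) - (1 + x i3) by ring.
by rewrite -eqx -[X in _ - X]mul1r -mulrBl D0 mul0r.
Qed.

Lemma coords_point x : admissible x -> coords (point x) = x.
Proof.
move=> adm_x; have nzD := admissible_denom adm_x; have [+ _ nzq _ _] := adm_x.
rewrite /on_quartic sum4 prod4 => eqx; have [nz0 nz1] := (nzq i0, nzq i1).
(* The quartic is linear in $x_3$, so $x_3$ is determined by the other three coordinates. *)
have def3 : x i3 = (x i0 + x i1 + x i2) / ((1 + x i0) * (1 + x i1) * (1 + x i2) - 1) - 1.
  apply: (mulIf nzD); rewrite mulrBl divfK // mulrBr mulr1 mul1r.
  have -> : x i0 + x i1 + x i2 - ((1 + x i0) * (1 + x i1) * (1 + x i2) - 1) =
    1 + (x i0 + x i1 + x i2 + x i3) - x i3 - (1 + x i0) * (1 + x i1) * (1 + x i2) by ring.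
  by rewrite -eqx; ring.
suff E i : coords (point x) i = x i :> L by apply/ffunP.
elim/ord4P: i; rewrite ffunE !(tnth_nth 0) /= /delta4.
- by field; rewrite ?oner_neq0 nz0.
- by field; rewrite ?oner_neq0 nz0 nz1.
- by field; rewrite ?oner_neq0 nz0 nz1 nzD.
- by rewrite def3; field; rewrite ?oner_neq0 nz0 nz1 nzD.
Qed.

Lemma coordsE P (r := tnth P 0) (s := tnth P 1) (t := tnth P 2) (x := coords P) :
  [/\ x i0 = (1 - r) / r, x i1 = (r ^+ 2 - t) / t,
  x i2 = (s * t + 1 - r * s) / (r * s) & x i3 = (t + s * delta4 r t - r) / r].
Proof. by split; rewrite ffunE. Qed.

Lemma pointE x (q := fun i => 1 + x i) : [/\ tnth (point x) 0 = (q i0)^-1,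
  tnth (point x) 1 = q i0 ^+ 2 * q i1 / (q i0 * q i1 * q i2 - 1)
  & tnth (point x) 2 = (q i0 ^+ 2 * q i1)^-1].
Proof. by []. Qed.

Lemma point_neq0 x : admissible x -> forall i, tnth (point x) i != 0.
Proof.
move=> adm_x; have nzD := admissible_denom adm_x; have [_ _ nzq _ _] := adm_x.
by move=> [[|[|[|//]]] lt_i]; rewrite (tnth_nth 0) /= ?mulf_neq0 ?invr_neq0
  ?mulf_neq0 ?expf_neq0.
Qed.

(** * The coordinates of a point $(r,s,t)$ and the maps [psi0], ..., [psi3] in these coordinates *)

Section AtPoint.
Variables (r s t : L).
Let P : 3.-tuple L := [tuple r; s; t].
Let x := coords P.
Hypotheses (nzr : r != 0) (nzs : s != 0) (nzt : t != 0).

Lemma coordsE3 : [/\ x i0 = (1 - r) / r, x i1 = (r ^+ 2 - t) / t,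
  x i2 = (s * t + 1 - r * s) / (r * s) & x i3 = (t + s * delta4 r t - r) / r].
Proof. exact: (coordsE P). Qed.

Lemma one_plus_coords : [/\ 1 + x i0 = r^-1, 1 + x i1 = r ^+ 2 / t,
  1 + x i2 = (s * t + 1) / (r * s) & 1 + x i3 = (t + s * delta4 r t) / r].
Proof.
have [-> -> -> ->] := coordsE3.
by split; field; rewrite ?nzr ?nzs ?nzt ?oner_neq0.
Qed.

Lemma point_coords : point x = P.
Proof.
have [q0 q1 q2 _] := one_plus_coords.
apply: eq_from_tnth => -[[|[|[|//]]] lt_i]; rewrite !(tnth_nth 0) /= ?q0 ?q1 ?q2.
- exact: invrK.
- by field; rewrite nzs nzr nzt (_ : _ + 1 + _ = 1) ?oner_neq0 //; ring.
- by field; rewrite ?nzs ?nzt ?nzr ?oner_neq0.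
Qed.

Lemma psi1_coords : psi1 P = point (permute (tperm i0 i1) x).
Proof.
have [q0 q1 q2 _] := one_plus_coords.
apply: eq_from_tnth => -[[|[|[|//]]] lt_i]; rewrite !(tnth_nth 0) /=
  !(tnth_nth 0) !permuteE !permE /= ?q0 ?q1 ?q2.
- by rewrite invf_div.
- by field; rewrite nzs nzr nzt (_ : _ + 1 + _ = 1) ?oner_neq0 //; ring.
- by field; rewrite ?nzs ?nzt ?nzr ?oner_neq0.
Qed.

Lemma psi2_coords : delta4 r t != 0 -> psi2 P = point (permute (tperm i2 i3) x).
Proof.
have [q0 q1 q2 q3] := one_plus_coords; rewrite /delta4 in q3 * => nzd.
apply: eq_from_tnth => -[[|[|[|//]]] lt_i]; rewrite !(tnth_nth 0) /=
  !(tnth_nth 0) !permuteE !permE /= ?q0 ?q1 ?q2 ?q3.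
- by rewrite invrK.
- field; rewrite nzr nzt nzd nzs !andbT /=.
  rewrite (_ : t + s * _ + _ = s * (r ^+ 3 - 3 * r * t + t ^+ 2 + t)); last by ring.
  exact: mulf_neq0.
- by field; rewrite ?nzs ?nzt ?nzr ?oner_neq0.
Qed.

Lemma psi3_coords : s * t + 1 != 0 -> psi3 P = point (permute (tperm i1 i2) x).
Proof.
have [q0 q1 q2 q3] := one_plus_coords => nzd.
apply: eq_from_tnth => -[[|[|[|//]]] lt_i]; rewrite !(tnth_nth 0) /=
  !(tnth_nth 0) !permuteE !permE /= ?q0 ?q1 ?q2 ?q3.
- by rewrite invrK.
- by field; rewrite ?nzs ?nzt ?nzr (_ : s * t + 1 + _ = 1) ?oner_neq0 //; ring.
- by field; rewrite nzs nzr nzd.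
Qed.

Lemma on_quartic_coords : on_quartic x.
Proof.
have [q0 q1 q2 q3] := one_plus_coords; have [x0 x1 x2 x3] := coordsE3.
rewrite /on_quartic prod4 q0 q1 q2 q3 sum4 x0 x1 x2 x3 /delta4.
by field; rewrite nzr nzs nzt.
Qed.

Lemma prod_one_plus_coords :
  \prod_i (1 + x i) = (s * t + 1) * (t + s * delta4 r t) / (r * s * t).
Proof.
have [q0 q1 q2 q3] := one_plus_coords; rewrite prod4 q0 q1 q2 q3.
by field; rewrite nzr nzs nzt.
Qed.

Lemma sum_sub_coords i :
  \sum_j x j - x i = (s * t + 1) * (t + s * delta4 r t) / (r * s * t) - (1 + x i).
Proof. by rewrite -prod_one_plus_coords on_quartic_coords; ring. Qed.

(** This identifies [Delta]: up to a monomial factor, it is the symmetric function $e_2$ of the four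
    coordinates. *)
Lemma e2_coords :
  (\sum_i x i) ^+ 2 - \sum_i x i ^+ 2 = 2 * Delta r s t / (r ^+ 2 * s * t).
Proof.
have [x0 x1 x2 x3] := coordsE3; rewrite !sum4 x0 x1 x2 x3 /Delta /delta4.
by field; rewrite nzr nzs nzt.
Qed.

Hypotheses (nz0 : 1 - r != 0) (nz1 : r ^+ 2 - t != 0).
Hypotheses (nz2 : s * t + 1 - r * s != 0) (nz3 : t + s * delta4 r t - r != 0).
Hypotheses (nzq2 : s * t + 1 != 0) (nzq3 : t + s * delta4 r t != 0).
Hypotheses (nzd4 : delta4 r t != 0) (nzDelta : Delta r s t != 0).
Hypothesis nzT0 : (s * t + 1) * (t + s * delta4 r t) - s * t != 0.
Hypothesis nzT1 : (s * t + 1) * (t + s * delta4 r t) - r ^+ 3 * s != 0.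

Lemma sum_sub_coordsE : [/\
  \sum_j x j - x i0 = ((s * t + 1) * (t + s * delta4 r t) - s * t) / (r * s * t),
  \sum_j x j - x i1 =
    ((s * t + 1) * (t + s * delta4 r t) - r ^+ 3 * s) / (r * s * t),
  \sum_j x j - x i2 = (s * t + 1) * (s * delta4 r t) / (r * s * t)
  & \sum_j x j - x i3 = (t + s * delta4 r t) / (r * s * t)].
Proof.
have [q0 q1 q2 q3] := one_plus_coords.
by split; rewrite sum_sub_coords ?q0 ?q1 ?q2 ?q3; field; rewrite nzr nzs nzt.
Qed.

Lemma admissible_coords : admissible x.
Proof.
have [q0 q1 q2 q3] := one_plus_coords; have [x0 x1 x2 x3] := coordsE3.
have [T0 T1 T2 T3] := sum_sub_coordsE.
split; first exact: on_quartic_coords.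
- by elim/ord4P; rewrite ?x0 ?x1 ?x2 ?x3 !mulf_neq0 ?invr_neq0 ?mulf_neq0.
- by elim/ord4P; rewrite ?q0 ?q1 ?q2 ?q3 ?mulf_neq0 ?invr_neq0 ?mulf_neq0 ?expf_neq0.
- by elim/ord4P; rewrite ?T0 ?T1 ?T2 ?T3 mulf_neq0 ?invr_neq0 ?mulf_neq0 ?mulf_neq0.
- by rewrite e2_coords !mulf_neq0 ?invr_neq0 ?mulf_neq0 ?expf_neq0.
Qed.

(** The six hypotheses are the numerators of the differences of the $1 + x_i$. *)
Lemma coords_inj : t - r ^+ 3 != 0 -> s - s * t - 1 != 0 ->
  1 - t - s * delta4 r t != 0 -> r ^+ 3 * s - s * t ^+ 2 - t != 0 ->
  r ^+ 3 - t ^+ 2 - s * t * delta4 r t != 0 -> 1 - s ^+ 2 * delta4 r t != 0 ->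
  injective x.
Proof.
move=> n01 n02 n03 n12 n13 n23.
have [q0 q1 q2 q3] := one_plus_coords.
have neq i j a b : 1 + x i = a -> 1 + x j = b -> a - b != 0 -> x i <> x j.
  by move=> <- <- nz xij; rewrite xij subrr eqxx in nz.
have x01 : x i0 <> x i1.
  apply: neq q0 q1 _; have -> : r^-1 - r ^+ 2 / t = (t - r ^+ 3) / (r * t).
    by field; rewrite nzr nzt.
  by rewrite mulf_neq0 ?invr_neq0 ?mulf_neq0.
have x02 : x i0 <> x i2.
  apply: neq q0 q2 _.
  have -> : r^-1 - (s * t + 1) / (r * s) = (s - s * t - 1) / (r * s).
    by field; rewrite nzr nzs.
  by rewrite mulf_neq0 ?invr_neq0 ?mulf_neq0.
have x03 : x i0 <> x i3.
  apply: neq q0 q3 _.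
  have -> : r^-1 - (t + s * delta4 r t) / r = (1 - t - s * delta4 r t) / r.
    by field.
  by rewrite mulf_neq0 ?invr_neq0 ?mulf_neq0.
have x12 : x i1 <> x i2.
  apply: neq q1 q2 _.
  have -> : r ^+ 2 / t - (s * t + 1) / (r * s) =
      (r ^+ 3 * s - s * t ^+ 2 - t) / (r * s * t).
    by field; rewrite nzr nzs nzt.
  by rewrite mulf_neq0 ?invr_neq0 ?mulf_neq0.
have x13 : x i1 <> x i3.
  apply: neq q1 q3 _.
  have -> : r ^+ 2 / t - (t + s * delta4 r t) / r =
      (r ^+ 3 - t ^+ 2 - s * t * delta4 r t) / (r * t).
    by field; rewrite nzr nzt.
  by rewrite mulf_neq0 ?invr_neq0 ?mulf_neq0.
have x23 : x i2 <> x i3.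
  apply: neq q2 q3 _.
  have -> : (s * t + 1) / (r * s) - (t + s * delta4 r t) / r =
      (1 - s ^+ 2 * delta4 r t) / (r * s).
    by field; rewrite nzr nzs.
  by rewrite mulf_neq0 ?invr_neq0 ?mulf_neq0.
by elim/ord4P; elim/ord4P=> // /esym.
Qed.

Lemma sum_coords_neq0 : (s * t + 1) * (t + s * delta4 r t) - r * s * t != 0 ->
  \sum_i x i != 0.
Proof.
move=> nz; have := on_quartic_coords; rewrite /on_quartic prod_one_plus_coords.
move/(canLR (addKr _)) => <-.
have -> : - 1 + (s * t + 1) * (t + s * delta4 r t) / (r * s * t) =
    ((s * t + 1) * (t + s * delta4 r t) - r * s * t) / (r * s * t).
  by field; rewrite nzr nzs nzt.
by rewrite mulf_neq0 ?invr_neq0 ?mulf_neq0.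
Qed.

(** The hypothesis says $e_2 \neq e_4$, after multiplication by $r^3 s t$. *)
Lemma ratio_coords_neq1 :
  Delta r s t * r -
    (1 - r) * (r ^+ 2 - t) * (s * t + 1 - r * s) * (t + s * delta4 r t - r) != 0 ->
  ratio x != 1.
Proof.
have [x0 x1 x2 x3] := coordsE3.
apply: contraNneq; rewrite /ratio e2_coords prod4 x0 x1 x2 x3 => rat1.
rewrite subr_eq0; apply/eqP/divr1_eq; rewrite -[RHS]rat1; field.
by rewrite nzr nzs nzt nz0 nz1 nz2 nz3 two_neq0.
Qed.

Lemma psi0_coords :
  psi0 P = point (permute (tperm i0 i2 * tperm i1 i3)%g (scale x)).
Proof.
have adm_x := admissible_coords; have [_ nzx nzq nzS _] := adm_x.
have [q0 q1 q2 q3] := one_plus_coords; have [x0 x1 x2 x3] := coordsE3.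
have [T0 T1 T2 T3] := sum_sub_coordsE.
have nzp1 : 1 + scale x i1 != 0 by case: (admissible_scale adm_x).
(* This is the denominator in the second component of [point]. Multiplied by $1 + c x_1$, it becomes
   $1 + c\sum_i x_i - (1 + c x_1)$ by the equation of the scaled quartic. *)
have p013 : (1 + scale x i2) * (1 + scale x i3) * (1 + scale x i0) - 1 =
    ratio x * (\sum_i x i - x i1) / (1 + scale x i1).
  apply: (canRL (mulfK nzp1)); have := on_quartic_scale adm_x.
  rewrite /on_quartic prod4 sum_scale => eqS.
  transitivity (1 + ratio x * \sum_i x i - (1 + scale x i1)); last first.
    by rewrite ffunE; ring.
  by rewrite -eqS; ring.
have [s0 s1 s2] : let s := (tperm i0 i2 * tperm i1 i3)%g in
    [/\ s i0 = i2, s i1 = i3 & s i2 = i0].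
  by split; apply: val_inj; rewrite permM !permE /= ?permE.
have d5 : delta5 r s t = t + s * delta4 r t by rewrite /delta5 /delta4; ring.
have nw : r * s - s * t - 1 != 0.
  have -> : r * s - s * t - 1 = - (s * t + 1 - r * s) by ring.
  by rewrite oppr_eq0.
have nr1 : r - 1 != 0 by rewrite -oppr_eq0 opprB.
have [P0 P1 P2] : [/\ tnth P 0 = r, tnth P 1 = s & tnth P 2 = t] by [].
apply: eq_from_tnth => -[[|[|[|//]]] lt_i]; rewrite /psi0 P0 P1 P2 !(tnth_nth 0) /=
  !permuteE ?s0 ?s1 ?s2 ?p013 !scaleE //
  ?T0 ?T1 ?T2 ?T3 ?q0 ?q1 ?q2 ?q3 ?/ratio ?e2_coords ?prod4 ?x0 ?x1 ?x2 ?x3 ?d5;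
  (* In factored form the identities hold with [delta4] and [Delta] as independent variables, which
     spares [field] their expansion. *)
  move: (delta4 r t) (Delta r s t) nz0 nz1 nz2 nz3 nzq2 nzq3 nzd4 nzDelta nzT0 nzT1 =>
    d D n0 n1 n2 n3 nq2 nq3 nd nD n4 n5.
- by field; rewrite nzr nzs nzt n0 n1 n2 n3 nq2 nd nw.
- by field; rewrite ?nzr ?nzs ?nzt ?n0 ?n1 ?n2 ?n3 ?nq2 ?nq3 ?nd ?nw ?nr1 ?nD
    ?n4 ?n5 ?two_neq0.
- by field; rewrite ?nzr ?nzs ?nzt ?n0 ?n1 ?n2 ?n3 ?nq2 ?nq3 ?nd ?nw ?nr1 ?nD
    ?n4 ?n5 ?two_neq0.
Qed.

End AtPoint.

End Coordinates.

(* The relation "a is defined at a given point, with value c", abstracted from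
   the function fields because [field] and [done] are impractical there. *)
Record field_correspondence (L1 L2 : fieldType) (R : L1 -> L2 -> Prop) : Prop := {
  correspond0 : R 0 0;
  correspond1 : R 1 1;
  correspondD : forall a b c d, R a c -> R b d -> R (a + b) (c + d);
  correspondN : forall a c, R a c -> R (- a) (- c);
  correspondM : forall a b c d, R a c -> R b d -> R (a * b) (c * d);
  correspondV : forall a c, c != 0 -> R a c -> R a^-1 c^-1;
  correspond_fun : forall a c d, R a c -> R a d -> c = d }.

Section Correspondence.
Variables (L1 L2 : fieldType) (R : L1 -> L2 -> Prop).
Hypothesis corr : field_correspondence R.

Lemma correspondX a c n : R a c -> R (a ^+ n) (c ^+ n).
Proof.
move=> ac; elim: n => [|n IHn]; first by rewrite !expr0; apply: correspond1.
by rewrite !exprS; apply: correspondM.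
Qed.

Lemma correspond_nat n : R n%:R n%:R.
Proof.
elim: n => [|n IHn]; first exact: correspond0.
by rewrite !mulrS; apply: correspondD => //; apply: correspond1.
Qed.

Lemma correspond_neq0 a c : R a c -> c != 0 -> a != 0.
Proof.
move=> ac; apply: contraNneq => a0; rewrite {}a0 in ac.
by apply/eqP; apply: (correspond_fun corr ac); apply: correspond0.
Qed.

End Correspondence.

(** The recursion follows the first argument only, so the value may be an existential variable that
    it fills in; nonvanishing of inverted values is left as a goal. *)
Ltac correspond := repeat
  match goal with
  | H : ?R ?a _ |- ?R ?a _ => exact H
  | |- _ 1 _ => apply: correspond1
  | |- _ (_ *+ _) _ => apply: correspond_nat
  | |- _ (- _) _ => apply: correspondN
  | |- _ (_ + _) _ => apply: correspondD
  | |- _ (_ * _) _ => apply: correspondM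
  | |- _ (_ ^+ _) _ => apply: correspondX
  | |- _ (_^-1) _ => apply: correspondV
  | H : field_correspondence ?R |- field_correspondence ?R => exact H
  end.

Section CorrespondingPoints.
Variables (L1 L2 : fieldType) (R : L1 -> L2 -> Prop).
Hypothesis corr : field_correspondence R.
Hypothesis two_neq0 : 2 != 0 :> L2.
Implicit Types (x : {ffun 'I_4 -> L1}) (y : {ffun 'I_4 -> L2}).
Implicit Types (P : 3.-tuple L1) (Q : 3.-tuple L2).

Lemma correspond_coords P Q : (forall i, R (tnth P i) (tnth Q i)) ->
  (forall i, tnth Q i != 0) -> forall i, R (coords P i) (coords Q i).
Proof.
move=> PQ nzQ; have [r s t] := And3 (PQ 0) (PQ 1) (PQ 2).
have [nzr nzs nzt] := And3 (nzQ 0) (nzQ 1) (nzQ 2).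
have [x0 x1 x2 x3] := coordsE P; have [y0 y1 y2 y3] := coordsE Q.
elim/ord4P; [rewrite x0 y0 | rewrite x1 y1 | rewrite x2 y2 | rewrite x3 y3 /delta4];
  by correspond; rewrite ?mulf_neq0.
Qed.

Lemma correspond_ratio x y : (forall i, R (x i) (y i)) ->
  admissible y -> R (ratio x) (ratio y).
Proof.
move=> xy [_ nzy _ _ _]; rewrite /ratio !sum4 !prod4.
have nzp : 2 * (y i0 * y i1 * y i2 * y i3) != 0.
  by rewrite -prod4 mulf_neq0 //; apply/prodf_neq0.
have [X0 X1 X2 X3] := And4 (xy i0) (xy i1) (xy i2) (xy i3).
by correspond.
Qed.

Lemma correspond_act g x y : (forall i, R (x i) (y i)) ->
  admissible y -> forall i, R (act g x i) (act g y i).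
Proof.
move=> xy adm_y i; rewrite /act !permuteE; case: ifP => _; first exact: xy.
by rewrite /scale !ffunE; apply: correspondM => //; apply: correspond_ratio.
Qed.

Lemma correspond_point x y : (forall i, R (x i) (y i)) ->
  admissible y -> forall i, R (tnth (point x) i) (tnth (point y) i).
Proof.
move=> xy adm_y; have nzD := admissible_denom adm_y.
have [_ _ nzq _ _] := adm_y; have [nz0 nz1] := (nzq i0, nzq i1).
have [X0 X1 X2 X3] := And4 (xy i0) (xy i1) (xy i2) (xy i3).
have nzN : (1 + y i0) ^+ 2 * (1 + y i1) != 0 by rewrite mulf_neq0 ?expf_neq0.
have [px0 px1 px2] := pointE x; have [py0 py1 py2] := pointE y.
case=> [[|[|[|//]]] lt_i].
- by rewrite (_ : Ordinal _ = 0) ?px0 ?py0; [correspond | apply: val_inj].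
- by rewrite (_ : Ordinal _ = 1) ?px1 ?py1; [correspond | apply: val_inj].
- by rewrite (_ : Ordinal _ = 2) ?px2 ?py2; [correspond | apply: val_inj].
Qed.

End CorrespondingPoints.

(** * Nonvanishing conditions and faithfulness at a generic point *)

Section GenericPoint.
Variables (L : fieldType) (r s t : L).
Hypothesis two_neq0 : 2 != 0 :> L.
Let P : 3.-tuple L := [tuple r; s; t].
Let x := coords P.
Hypothesis generic : forall a b c : nat, exists R : L -> L -> Prop,
  field_correspondence R /\ [/\ R r a%:R, R s b%:R & R t c%:R].

Lemma eq1_neq0 (c : L) : c = 1 -> c != 0.
Proof. by move->; apply: oner_neq0. Qed.

Lemma eqN1_neq0 (c : L) : c = -1 -> c != 0.
Proof. by move->; rewrite oppr_eq0 oner_neq0. Qed.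

(* A polynomial in r, s, t is nonzero as soon as it takes the value 1 or -1 at an
   integer point; this is independent of the characteristic. *)
Ltac nonzero_at a b c :=
  let R := fresh in let corrR := fresh in
  have [R [corrR [? ? ?]]] := generic a b c; rewrite /Delta /delta4;
  apply: (correspond_neq0 corrR); first (by correspond);
  first [apply: eq1_neq0; ring | apply: eqN1_neq0; ring].

Lemma generic_coord_neq0 : [/\ r != 0, s != 0 & t != 0].
Proof. by split; nonzero_at 1%N 1%N 1%N. Qed.

Lemma generic_q_neq0 : [/\ s * t + 1 != 0, t + s * delta4 r t != 0 & delta4 r t != 0].
Proof.
by split; [nonzero_at 0%N 0%N 0%N | nonzero_at 0%N 0%N 1%N
  | nonzero_at 1%N 0%N 0%N].
Qed.

Lemma generic_admissible : admissible x.
Proof.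
have [nzr nzs nzt] := generic_coord_neq0; have [nzq2 nzq3 nzd4] := generic_q_neq0.
apply: admissible_coords => //;
  first [nonzero_at 0%N 0%N 0%N | nonzero_at 1%N 0%N 0%N | nonzero_at 0%N 0%N 1%N].
Qed.

Lemma generic_psi0 :
  psi0 P = point (permute (tperm i0 i2 * tperm i1 i3)%g (scale x)).
Proof.
have [nzr nzs nzt] := generic_coord_neq0; have [nzq2 nzq3 nzd4] := generic_q_neq0.
apply: psi0_coords => //;
  first [nonzero_at 0%N 0%N 0%N | nonzero_at 1%N 0%N 0%N | nonzero_at 0%N 0%N 1%N].
Qed.

Lemma generic_coords_inj : injective x.
Proof.
have [nzr nzs nzt] := generic_coord_neq0.
by apply: coords_inj => //; first [nonzero_at 1%N 0%N 0%N | nonzero_at 1%N 0%N 1%N].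
Qed.

Lemma generic_sum_neq0 : \sum_i x i != 0.
Proof.
have [nzr nzs nzt] := generic_coord_neq0.
by apply: sum_coords_neq0 => //; nonzero_at 0%N 0%N 1%N.
Qed.

Lemma generic_ratio_neq1 : ratio x != 1.
Proof.
have [nzr nzs nzt] := generic_coord_neq0; have [nzq2 nzq3 nzd4] := generic_q_neq0.
apply: ratio_coords_neq1 => //;
  first [nonzero_at 0%N 0%N 0%N | nonzero_at 1%N 0%N 0%N | nonzero_at 0%N 0%N 1%N].
Qed.

(** A pure permutation fixing [x] is trivial because the coordinates are distinct. If scaling
    occurs, summing the coordinates gives $c \sum_i x_i = \sum_i x_i$, hence $c = 1$, which is
    excluded. *)
Lemma generic_act_faithful g : act g x = x -> g = 1%g.
Proof.
case: g => e a /ffunP fix_x.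
have [e0|e0] := eqVneq e 0.
  rewrite e0 in fix_x *; congr (_, _); apply/permP=> i; rewrite perm1.
  by apply: generic_coords_inj; have := fix_x i; rewrite /act eqxx permuteE.
have scale_x i : ratio x * x (a i) = x i.
  by have := fix_x i; rewrite /act /= (negPf e0) permuteE ffunE.
have := generic_ratio_neq1.
suff -> : ratio x = 1 by rewrite eqxx.
apply: (mulIf generic_sum_neq0); rewrite mul1r.
rewrite {1}(reindex_inj (@perm_inj _ a)) mulr_sumr /=.
by apply: eq_bigr => i _.
Qed.

End GenericPoint.

(** * The group of symmetries of (r, s, t)-space *)

Local Opaque coords point scale permute psubst.

Lemma specializes_correspondence (F : fieldType) (n m : nat)
  (w : n.-tuple (ratfun F m)) : field_correspondence (specializes w).
Proof.
split; first exact: (specializes_nat w 0).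
- exact: (specializes_nat w 1).
- by move=> a b c d; apply: specializesD.
- by move=> a c; apply: specializesN.
- by move=> a b c d; apply: specializesM.
- by move=> a c; apply: specializesV.
- by move=> a c d; apply: specializes_fun.
Qed.

Lemma specializes_var (F : fieldType) (n m : nat) (w : n.-tuple (ratfun F m)) i :
  specializes w (tofrac 'X_i) (tnth w i).
Proof. by rewrite -(psubst_var w); apply: specializes_poly. Qed.

Section SymmetryGroup.
Variable k : fieldType.
Hypothesis two_k : 2 != 0 :> k.
Local Notation K := (ratfun k 3).
Local Notation rst := (ratmap_id k 3).
Implicit Types (g h : 'Z_2 * 'S_4).

Lemma two_K : 2 != 0 :> K.
Proof. by rewrite -(rmorph_nat (@ratfunC k 3)) fmorph_eq0. Qed.

Local Notation r := (tofrac 'X_(0 : 'I_3) : K).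
Local Notation s := (tofrac 'X_(1 : 'I_3) : K).
Local Notation t := (tofrac 'X_(2 : 'I_3) : K).

Lemma rstE : rst = [tuple r; s; t].
Proof.
apply: eq_from_tnth => -[[|[|[|//]]] lt_i]; rewrite tnth_mktuple (tnth_nth 0) /=;
  by congr (tofrac 'X_ _); apply: val_inj.
Qed.

(** Evaluation at an integer point, viewed as a tuple of constant functions so that [specializes]
    applies. *)
Lemma rst_generic (a b c : nat) : exists R : K -> K -> Prop,
  field_correspondence R /\ [/\ R r a%:R, R s b%:R & R t c%:R].
Proof.
pose w : 3.-tuple K := [tuple a%:R; b%:R; c%:R]; exists (specializes w).
split; first exact: specializes_correspondence.
by split; exact: (specializes_var w).
Qed.

Local Notation x := (coords rst).

Lemma rst_admissible : admissible x.
Proof. by rewrite rstE; apply: generic_admissible two_K rst_generic. Qed.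

Definition symmetry g : ratmap k 3 := point (act g x).

Lemma symmetry1 : symmetry 1%g = rst.
Proof.
rewrite /symmetry act1 rstE; have [nzr nzs nzt] := generic_coord_neq0 rst_generic.
exact: point_coords nzr nzs nzt.
Qed.

(** Substituting [symmetry h] turns the generic coordinates into those of [symmetry h], which are
    [act h x] by [coords_point]; applying [act g] and [point] then gives the composite without
    expanding any formula. *)
Lemma specializes_symmetry g h i :
  specializes (symmetry h) (tnth (symmetry g) i) (tnth (symmetry (g * h)%g) i).
Proof.
have adm_h := admissible_act two_K h rst_admissible.
have corr := specializes_correspondence (symmetry h).
rewrite {3}/symmetry -(actM two_K _ _ rst_admissible).
apply: (correspond_point corr); last exact: admissible_act two_K _ _ adm_h.
apply: (correspond_act corr two_K) => // j.
rewrite -(coords_point adm_h); apply: (correspond_coords corr).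
  by move=> l; rewrite tnth_mktuple; apply: specializes_var.
exact: point_neq0.
Qed.

Lemma symmetry_dominant g : dominant (symmetry g).
Proof.
apply: (@dominant_of_inverse _ _ _ (symmetry g^-1%g)) => i.
by rewrite -symmetry1 -(mulgV g); apply: specializes_symmetry.
Qed.

Lemma symmetryM g h : symmetry (g * h)%g = ratmap_comp (symmetry g) (symmetry h).
Proof.
apply/esym/ratmap_compP; first exact: symmetry_dominant.
exact: specializes_symmetry.
Qed.

Lemma symmetry_inj : injective symmetry.
Proof.
move=> g h /(congr1 (@coords K)).
rewrite !coords_point; try exact: admissible_act two_K _ _ rst_admissible.
move/(congr1 (act h^-1%g)); rewrite !(actM two_K _ _ rst_admissible) mulVg act1.
have := @generic_act_faithful _ _ _ _ two_K rst_generic (h^-1 * g)%g.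
by rewrite -rstE => faithful /faithful/(congr1 (mulg h)); rewrite mulKVg mulg1.
Qed.

Definition transposition (i j : 'I_4) : 'Z_2 * 'S_4 := (0, tperm i j).
(** The element corresponding to [psi0]: its component in ['Z_2] stands for the scaling
    involution. *)
Definition dual_swap : 'Z_2 * 'S_4 := (1, (tperm i0 i2 * tperm i1 i3)%g).

Lemma psi_symmetry : [/\ psi0 rst = symmetry dual_swap,
  psi1 rst = symmetry (transposition i0 i1),
  psi2 rst = symmetry (transposition i2 i3)
  & psi3 rst = symmetry (transposition i1 i2)].
Proof.
have [nzr nzs nzt] := generic_coord_neq0 rst_generic.
have [nzq2 nzq3 nzd4] := generic_q_neq0 rst_generic.
rewrite /symmetry /act /= rstE; split.
- exact: generic_psi0 two_K rst_generic.
- exact: psi1_coords nzr nzs nzt.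
- exact: psi2_coords nzr nzs nzt nzd4.
- exact: psi3_coords nzr nzs nzt nzq2.
Qed.

End SymmetryGroup.

(** * Generators of the symmetry groups and the two isomorphisms *)

Section Isomorphisms.
Variable k : fieldType.
Hypothesis two_k : 2 != 0 :> k.
Local Notation rst := (ratmap_id k 3).
Local Open Scope group_scope.

(** Conjugation of adjacent transpositions yields all transpositions involving [i0], and these
    generate by [gen_tperm]. *)
Lemma gen_adjacent_tperm :
  <<[set a in [:: tperm i0 i1; tperm i2 i3; tperm i1 i2]]>> = [set: 'S_4].
Proof.
set G := <<[set a in _]>>.
apply/eqP; rewrite eqEsubset subsetT -(gen_tperm i0) gen_subG.
have [t01 t23 t12] : [/\ tperm i0 i1 \in G, tperm i2 i3 \in G & tperm i1 i2 \in G].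
  by split; apply: mem_gen; rewrite !inE eqxx ?orbT.
have t02 : tperm i0 i2 \in G.
  by have := groupJ t01 t12; rewrite tpermJ tpermD // tpermL.
have t03 : tperm i0 i3 \in G.
  by have := groupJ t02 t23; rewrite tpermJ tpermD // tpermL.
by apply/subsetP=> _ /imsetP[y _ ->]; elim/ord4P: y => //; rewrite tperm1 group1.
Qed.

Lemma pair1g_gen_adjacent_tperm :
  <<[set g in [:: transposition i0 i1; transposition i2 i3; transposition i1 i2]]>>
  = setX 1 [set: 'S_4].
Proof.
rewrite -gen_adjacent_tperm -morphim_pair1g morphim_gen ?subsetT //.
congr <<_>>; apply/setP=> -[e a]; rewrite morphim_pair1g !inE /= !xpair_eqE.
by rewrite -!andb_orr.
Qed.

(** The transpositions give the whole subgroup $1 \times S_4$, and [dual_swap] represents its only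
    other coset. *)
Lemma gen_symmetries :
  <<[set g in [:: dual_swap; transposition i0 i1; transposition i2 i3;
                  transposition i1 i2]]>> = [set: 'Z_2 * 'S_4].
Proof.
set G := <<[set g in _]>>; apply/eqP; rewrite eqEsubset subsetT /=.
have G0 a : (0%R, a) \in G.
  suff /subsetP : setX 1 [set: 'S_4] \subset G by apply; rewrite !inE.
  rewrite -pair1g_gen_adjacent_tperm genS //; apply/subsetP=> g.
  by rewrite !inE => ->; rewrite orbT.
apply/subsetP=> -[e a] _; have [->|e1] := eqVneq e 0%R; first exact: G0.
have -> : (e, a) = dual_swap * (0%R, dual_swap.2^-1 * a).
  congr (_, _); last by rewrite mulKVg.
  by case: e e1 => [[|[|//]] lt_e] // _; apply: val_inj.
by rewrite groupM ?G0 // mem_gen // !inE eqxx.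
Qed.

Lemma symmetries_isomorphic :
  isomorphic_to_group (ratmap_gen [:: psi1 rst; psi2 rst; psi3 rst]) PGL2F3
  /\ isomorphic_to_group (ratmap_gen [:: psi0 rst; psi1 rst; psi2 rst; psi3 rst])
       (setX_group [set: 'Z_2]%G PGL2F3).
Proof.
have /isogP[j /injmP j_inj im_j] := PGL2F3_isog.
have [-> -> -> ->] := psi_symmetry two_k; split.
- apply: (isomorphic_to_group_phi (symmetry_dominant two_k) (symmetry1 k)
    (symmetryM two_k) (f := fun a => (0%R : 'Z_2, j a))
    (s := [:: transposition i0 i1; transposition i2 i3; transposition i1 i2])
    (symmetry_inj two_k)) => //.
  + by move=> a b Ga Gb; congr (_, _); [apply: val_inj | apply: morphM].
  + by move=> a b Ga Gb /= /(congr1 snd)/j_inj; apply.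
  + rewrite pair1g_gen_adjacent_tperm; apply/setP=> -[e a]; rewrite !inE andbT /=.
    apply/imsetP/eqP=> [[b _ [-> _]] //|->].
    have : a \in j @* PGL2F3 by rewrite im_j inE.
    by case/morphimP=> b _ Gb ->; exists b.
- apply: (isomorphic_to_group_phi (symmetry_dominant two_k) (symmetry1 k)
    (symmetryM two_k) (f := fun a => (a.1, j a.2))
    (s := [:: dual_swap; transposition i0 i1; transposition i2 i3;
              transposition i1 i2])
    (symmetry_inj two_k)) => //.
  + move=> a b; rewrite !inE /= => Ga Gb; congr (_, _); exact: morphM.
  + move=> [a1 a2] [b1 b2]; rewrite !inE /= => Ga Gb [-> /j_inj ->] //.
  + rewrite gen_symmetries; apply/setP=> -[e a]; rewrite inE; apply/imsetP.
    have : a \in j @* PGL2F3 by rewrite im_j inE.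
    by case/morphimP=> b _ Gb ->; exists (e, b) => //; rewrite inE /= inE.
Qed.

End Isomorphisms.

(** * Birational equivalence of the curves *)

Definition sextic (L : fieldType) (r s t x : L) : L :=
  ((s - s * t - 1) * x ^+ 3 + 3 * s * (r - t) * x ^+ 2
    + 3 * s * r * (r - t) * x + (- s * t ^+ 2 + s * r ^+ 3 + t)) ^+ 2
  + 4 * s * (x ^+ 2 + r * x + t) ^+ 3.

(* The substitution x = (a x' + b) / (c x' + d), y = e y' / (c x' + d)^3 maps
   the curve with parameters P to the one with parameters Q. *)
Record mobius_equivalence (L : fieldType) (P Q : 3.-tuple L) (a b c d e : L) : Prop := {
  mobius_det : a * d - b * c != 0;
  mobius_scalar : e != 0;
  mobius_sextic : forall (E : fieldType) (iota : {rmorphism L -> E}) (x : E),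
    iota c * x + iota d != 0 ->
    sextic (iota (tnth Q 0)) (iota (tnth Q 1)) (iota (tnth Q 2))
      ((iota a * x + iota b) / (iota c * x + iota d)) * (iota c * x + iota d) ^+ 6
    = iota e ^+ 2 * sextic (iota (tnth P 0)) (iota (tnth P 1)) (iota (tnth P 2)) x }.

(** The identity is applied at the inverse transform of [x], where the denominator $cx+d$ becomes
    $(ad-bc)/(-cx+a)$; its cube accounts for the new scalar. *)
Lemma mobius_equivalence_sym (L : fieldType) (P Q : 3.-tuple L) (a b c d e : L) :
  mobius_equivalence P Q a b c d e ->
  mobius_equivalence Q P d (- b) (- c) a ((a * d - b * c) ^+ 3 / e).
Proof.
case=> nzdet nze eqPQ; split=> [||E iota x nzD].
- by rewrite mulrC mulrNN.
- by rewrite mulf_neq0 ?expf_neq0 ?invr_neq0.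
have {}nzdet : iota (a * d - b * c) != 0 by rewrite fmorph_eq0.
have {}nze : iota e != 0 by rewrite fmorph_eq0.
move: nzdet nze (eqPQ E iota) => {eqPQ}.
rewrite fmorph_div !rmorphXn !rmorphB !rmorphM !rmorphN.
rewrite rmorphN in nzD.
move: (iota a) (iota b) (iota c) (iota d) (iota e) nzD => {}a {}b {}c {}d {}e nzD.
move=> nzdet nze /(_ ((d * x - b) / (- c * x + a))).
have -> : c * ((d * x - b) / (- c * x + a)) + d = (a * d - b * c) / (- c * x + a).
  by field.
rewrite mulf_neq0 ?invr_neq0 // => /(_ isT).
have -> : (a * ((d * x - b) / (- c * x + a)) + b) / ((a * d - b * c) / (- c * x + a)) = x.
  by field; rewrite nzD nzdet.
move: (sextic _ _ _ _) (sextic _ _ _ _) => SP SQ eqS.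
have -> : SP = SQ * ((a * d - b * c) / (- c * x + a)) ^+ 6 / e ^+ 2.
  by rewrite eqS mulrC mulKf ?expf_neq0.
by field; rewrite nzD nze.
Qed.

(** * Identities for fractional linear substitutions, over an abstract field *)

Section RescalingIdentities.
Variable E : fieldType.
Implicit Types (x y a b c d e D : E).

Lemma sextic_rescale y e SP SQ D : D != 0 -> SQ * D ^+ 6 = e ^+ 2 * SP ->
  (e * y / D ^+ 3) ^+ 2 - SQ = e ^+ 2 * (y ^+ 2 - SP) / D ^+ 6.
Proof.
move=> nzD eqS; have -> : SQ = e ^+ 2 * SP / D ^+ 6 by rewrite -eqS mulfK ?expf_neq0.
by field.
Qed.

Lemma mobius_denomK a b c d x : c * x + d != 0 ->
  - c * ((a * x + b) / (c * x + d)) + a = (a * d - b * c) / (c * x + d).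
Proof. by move=> nzD; field. Qed.

Lemma mobius_numK a b c d x : c * x + d != 0 ->
  d * ((a * x + b) / (c * x + d)) - b = (a * d - b * c) * x / (c * x + d).
Proof. by move=> nzD; field. Qed.

Lemma mobiusK m x D : m != 0 -> D != 0 -> m * x / D / (m / D) = x.
Proof. by move=> nzm nzD; field; rewrite nzm nzD. Qed.

Lemma mobius_ordinateK m e y D : m != 0 -> e != 0 -> D != 0 ->
  m ^+ 3 / e * (e * y / D ^+ 3) / (m / D) ^+ 3 = y.
Proof. by move=> nzm nze nzD; field; rewrite nzm nze nzD. Qed.

End RescalingIdentities.

Section CurveMaps.
Variable L : fieldType.
Implicit Types (P Q : 3.-tuple L) (p q f : {mpoly L[2]}).
Local Notation K := (ratfun L 2).
Local Notation C := (@ratfunC L 2).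

Lemma psubst_curve P (u : 2.-tuple K) :
  psubst (curve P) u = tnth u 1 ^+ 2
   - sextic (C (tnth P 0)) (C (tnth P 1)) (C (tnth P 2)) (tnth u 0).
Proof.
rewrite /curve /sextic !psubstE.
by rewrite !(rmorphB, rmorphD, rmorphM, rmorphN, rmorphXn, rmorph1, rmorph_nat).
Qed.

Lemma tofrac_curve P : tofrac (curve P) = tofrac 'X_1 ^+ 2
   - sextic (C (tnth P 0)) (C (tnth P 1)) (C (tnth P 2)) (tofrac 'X_0).
Proof. by rewrite -psubst_id psubst_curve !tnth_mktuple. Qed.

(* Polynomials in y over L[x], so that the degree in y bounds divisibility. *)
Definition y_coord (i : 'I_2) : {poly {poly L}} := if i == 0 then ('X)%:P else 'X.

Definition y_expansion : {rmorphism {mpoly L[2]} -> {poly {poly L}}} :=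
  mmap (polyC \o polyC) y_coord.

Lemma y_expansion_x : y_expansion 'X_0 = ('X)%:P.
Proof. by rewrite /y_expansion /= mmapX mmap1U. Qed.

Lemma y_expansion_y : y_expansion 'X_1 = 'X.
Proof. by rewrite /y_expansion /= mmapX mmap1U. Qed.

Lemma y_expansionC c : y_expansion c%:MP = c%:P%:P.
Proof. exact: mmapC. Qed.

Lemma size_y_expansion_curve P : size (y_expansion (curve P)) = 3.
Proof.
rewrite /curve -!mul_mpolyC rmorphB rmorphXn y_expansion_y.
rewrite !(rmorphD y_expansion, rmorphM y_expansion, rmorphXn y_expansion).
rewrite y_expansion_x !y_expansionC.
rewrite !(=^~ polyCM, =^~ polyCD, =^~ polyC_exp).
by rewrite size_XnsubC.
Qed.

(** The equation of the curve has degree 2 in $y$, so it cannot divide a nonzero polynomial of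
    degree 0 in $y$. *)
Lemma curve_ndvd P p : size (y_expansion p) = 1%N -> ~ mdivides (curve P) p.
Proof.
move=> size_p [q def_p]; move: size_p; rewrite def_p rmorphM /=.
have [->|nzq] := eqVneq (y_expansion q) 0; first by rewrite mul0r size_poly0.
have nzf : y_expansion (curve P) != 0 by rewrite -size_poly_eq0 size_y_expansion_curve.
rewrite size_mul // size_y_expansion_curve; move: nzq; rewrite -size_poly_gt0.
by case: (size _) => // n _; rewrite addn3.
Qed.

Definition linx (a b : L) : {mpoly L[2]} := a *: 'X_0 + b%:MP.

Lemma size_linx (a b : L) n : (a != 0) || (b != 0) ->
  size (y_expansion (linx a b ^+ n)) = 1%N.
Proof.
move=> nzab; rewrite rmorphXn /linx -mul_mpolyC rmorphD rmorphM /=.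
rewrite y_expansion_x !y_expansionC -polyCM -polyCD -polyC_exp size_polyC.
suff -> : (a%:P * 'X + b%:P) ^+ n != 0 by [].
apply: expf_neq0; apply: contraTneq nzab => /polyP ab0.
have := ab0 1%N; have := ab0 0%N.
rewrite !coefD !coefCM !coefX !coefC /= !mulr0 mulr1 addr0 add0r.
by move=> -> ->; rewrite eqxx.
Qed.

Lemma tofrac_linx a b : tofrac (linx a b) = C a * tofrac 'X_0 + C b.
Proof. by rewrite -psubst_id !psubstE tnth_mktuple. Qed.

(** If $m/p = a/b$ with [a] divisible by the equation of the curve, then $mb = ap$ makes [b]
    divisible as well, since [m] is a nonzero constant. *)
Lemma not_null_quotient P (m : L) p : m != 0 -> p != 0 ->
  ~ null_on (curve P) (C m / tofrac p).
Proof.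
move=> nzm nzp [a [b [[q def_a] ndvd_b]]].
have nzb : b != 0 by apply/eqP=> b0; case: ndvd_b; exists 0; rewrite b0 mul0r.
move/eqP; rewrite eqr_div ?tofrac_eq0 // -!tofracM tofrac_eq => /eqP eqmb.
case: ndvd_b; exists (m^-1 *: (q * p)).
rewrite -[LHS]scale1r -(mulVf nzm) -scalerA -(mul_mpolyC m) eqmb def_a -scalerAl.
by rewrite mulrAC.
Qed.

Lemma null_on0 P : null_on (curve P) 0.
Proof.
exists 0, 1; split; [by exists 0; rewrite mul0r | | by rewrite tofrac0 mul0r].
by apply: curve_ndvd; rewrite rmorph1 size_poly1.
Qed.

Section Mobius.
Variables (P Q : 3.-tuple L) (a b c d e : L).
Hypothesis eqPQ : mobius_equivalence P Q a b c d e.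

Definition mobius_map : 2.-tuple K :=
  [tuple tofrac (linx a b) / tofrac (linx c d);
         tofrac (e *: 'X_1) / tofrac (linx c d ^+ 3)].

Lemma mobius_denom : (c != 0) || (d != 0).
Proof.
have := mobius_det eqPQ; apply: contraNT.
rewrite negb_or !negbK => /andP[/eqP-> /eqP->].
by rewrite !mulr0 subrr.
Qed.

Lemma linx_neq0 (a' b' : L) : (a' != 0) || (b' != 0) -> linx a' b' != 0.
Proof.
move=> /(size_linx 1) sz; apply/eqP=> lin0; move: sz.
by rewrite expr1 lin0 rmorph0 size_poly0.
Qed.

Lemma mobius_curve_ratmap : curve_ratmap (curve P) (curve Q) mobius_map.
Proof.
have nzD := linx_neq0 mobius_denom.
split.
  case=> [[|[|//]] lt_i]; rewrite (tnth_nth 0) /=.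
    exists (linx a b), (linx c d); split=> //; apply: curve_ndvd.
    by rewrite -[linx c d]expr1 size_linx ?mobius_denom.
  exists (e *: 'X_1), (linx c d ^+ 3); split=> //; apply: curve_ndvd.
  exact: size_linx mobius_denom.
(* The pullback of the equation for [Q] is $e^2$ times the equation for [P], divided by
   $(cx+d)^6$. *)
exists (e ^+ 2 *: curve P), (linx c d ^+ 6); split.
- by exists (e ^+ 2)%:MP; rewrite mul_mpolyC.
- by apply: curve_ndvd; apply: size_linx mobius_denom.
have nzX : C c * tofrac 'X_0 + C d != 0 by rewrite -tofrac_linx tofrac_eq0.
have := mobius_sextic eqPQ nzX.
rewrite psubst_curve [tnth mobius_map 0](tnth_nth 0) [tnth mobius_map 1](tnth_nth 0) /=.
rewrite -!mul_mpolyC !tofracXn !tofracM tofrac_curve !tofrac_linx.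
rewrite -/(C e) -/(C (e ^+ 2)).
have -> : C (e ^+ 2) = C e ^+ 2 by rewrite rmorphXn.
exact: sextic_rescale.
Qed.

End Mobius.

(** The two substitutions are mutually inverse already in $L(x,y)$, so the differences that must be
    null are 0. The denominators pull back to $(ad-bc)/(cx+d)$ and its cube. *)
Lemma mobius_comp_id P Q a b c d e : mobius_equivalence P Q a b c d e ->
  curve_comp_id (curve P) (mobius_map a b c d e)
    (mobius_map d (- b) (- c) a ((a * d - b * c) ^+ 3 / e)).
Proof.
move=> eqPQ; have nzD := linx_neq0 (mobius_denom eqPQ).
have nzdet := mobius_det eqPQ; have nze := mobius_scalar eqPQ.
have nzx : C c * tofrac 'X_0 + C d != 0 by rewrite -tofrac_linx tofrac_eq0.
set u := mobius_map a b c d e.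
have u0 : tnth u 0 = (C a * tofrac 'X_0 + C b) / (C c * tofrac 'X_0 + C d).
  by rewrite -!tofrac_linx.
have u1 : tnth u 1 = C e * tofrac 'X_1 / (C c * tofrac 'X_0 + C d) ^+ 3.
  by rewrite -!tofrac_linx -tofracXn -tofracM mul_mpolyC.
have nzCdet : C (a * d - b * c) != 0 by rewrite fmorph_eq0.
have nzCe : C e != 0 by rewrite fmorph_eq0.
have Cdet : C (a * d - b * c) = C a * C d - C b * C c by rewrite rmorphB !rmorphM.
have CN m : C (- m) = - C m by rewrite rmorphN.
have denomE : psubst (linx (- c) a) u = C (a * d - b * c) / tofrac (linx c d).
  have -> : psubst (linx (- c) a) u = C (- c) * tnth u 0 + C a by rewrite !psubstE.
  by rewrite u0 tofrac_linx Cdet CN; exact: (mobius_denomK (C a) (C b) nzx).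
have numE : psubst (linx d (- b)) u =
    C (a * d - b * c) * tofrac 'X_0 / tofrac (linx c d).
  have -> : psubst (linx d (- b)) u = C d * tnth u 0 + C (- b) by rewrite !psubstE.
  by rewrite u0 tofrac_linx Cdet CN; exact: (mobius_numK (C a) (C b) nzx).
have nzlin : tofrac (linx c d) != 0 by rewrite tofrac_eq0.
case=> [[|[|//]] lt_i].
- exists (linx d (- b)), (linx (- c) a); split; first by rewrite (tnth_nth 0).
    by rewrite denomE; apply: not_null_quotient.
  rewrite denomE numE (mobiusK _ nzCdet nzlin) (_ : Ordinal _ = 0); last exact: val_inj.
  by rewrite subrr; apply: null_on0.
- exists (((a * d - b * c) ^+ 3 / e) *: 'X_1), (linx (- c) a ^+ 3).
  rewrite psubstX denomE; split; first by rewrite (tnth_nth 0).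
    rewrite expr_div_n -rmorphXn -tofracXn.
    by apply: not_null_quotient; rewrite expf_neq0.
  have -> : psubst (((a * d - b * c) ^+ 3 / e) *: 'X_1) u =
      C (a * d - b * c) ^+ 3 / C e * tnth u 1.
    by rewrite psubstZ psubst_var fmorph_div rmorphXn.
  rewrite u1 -tofrac_linx (mobius_ordinateK _ nzCdet nzCe nzlin).
  rewrite (_ : Ordinal _ = 1); last exact: val_inj.
  by rewrite subrr; apply: null_on0.
Qed.

Lemma mobius_birational P Q a b c d e : mobius_equivalence P Q a b c d e ->
  birationally_equivalent (curve P) (curve Q).
Proof.
move=> eqPQ; have eqQP := mobius_equivalence_sym eqPQ.
exists (mobius_map a b c d e).
exists (mobius_map d (- b) (- c) a ((a * d - b * c) ^+ 3 / e)).
split; [exact: mobius_curve_ratmap eqPQ | exact: mobius_curve_ratmap eqQP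
  | exact: mobius_comp_id eqPQ |].
(* Inverting the substitution twice gives back the original coefficients: the determinant is
   unchanged and the scalar returns to [e]. *)
have := mobius_comp_id eqQP; rewrite !opprK.
have -> : (d * a - - b * - c) = a * d - b * c by ring.
have nzdet := mobius_det eqPQ; have nze := mobius_scalar eqPQ.
have -> // : (a * d - b * c) ^+ 3 / ((a * d - b * c) ^+ 3 / e) = e.
by field; rewrite nze nzdet.
Qed.

End CurveMaps.

(** * Explicit substitutions for [psi1], [psi2] and [psi3] *)

Section MobiusIdentities.
Variables (E : fieldType) (r s t x : E).
Hypotheses (nzr : r != 0) (nzs : s != 0) (nzt : t != 0).

Lemma sextic_psi1 : r * x != 0 ->
  sextic r s t (t / (r * x)) * (r * x) ^+ 6 =
  (t * r ^+ 3) ^+ 2 * sextic (t / r ^+ 2) (r ^+ 3 * s / t) (t ^+ 2 / r ^+ 3) x.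
Proof.
rewrite mulf_eq0 negb_or => /andP[_ nzx].
by rewrite /sextic; field; rewrite nzr nzt nzx.
Qed.

Lemma sextic_psi2 (d := r ^+ 3 - 3 * r * t + t ^+ 2 + t) :
  d != 0 -> (1 - r) * x + (r - t) != 0 ->
  sextic r s t ((- (r - t) * x - (r ^+ 2 - t)) / ((1 - r) * x + (r - t)))
    * ((1 - r) * x + (r - t)) ^+ 6 =
  (s * d ^+ 2) ^+ 2 * sextic r (s * d)^-1 t x.
Proof.
move=> nzd nzD; rewrite /sextic /d in nzd *.
by field; rewrite nzs nzd nzD.
Qed.

Lemma sextic_psi3 : s * t + 1 != 0 -> x + r != 0 ->
  sextic r s t (- r * x / (x + r)) * (x + r) ^+ 6 =
  (r ^+ 3) ^+ 2 * sextic r (t * (s * t + 1) / r ^+ 3) (r ^+ 3 * s / (s * t + 1)) x.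
Proof.
move=> nzst nzD; rewrite /sextic.
by field; rewrite nzr nzst nzD.
Qed.

End MobiusIdentities.

Section PsiEquivalences.
Variables (L : fieldType) (r s t : L).
Let P : 3.-tuple L := [tuple r; s; t].
Hypotheses (nzr : r != 0) (nzs : s != 0) (nzt : t != 0).

Lemma psi1_mobius : mobius_equivalence (psi1 P) P 0 t r 0 (t * r ^+ 3).
Proof.
split=> [||E iota x]; first by rewrite mul0r sub0r oppr_eq0 mulf_neq0.
  by rewrite mulf_neq0 ?expf_neq0.
rewrite !(tnth_nth 0) /= !(tnth_nth 0) /= rmorph0 mul0r add0r addr0 => nzD.
rewrite !(fmorphV, rmorphM, rmorphXn).
by apply: sextic_psi1; rewrite ?fmorph_eq0.
Qed.

(** The substitution has determinant $-\delta_4$. *)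
Lemma psi2_mobius : delta4 r t != 0 ->
  mobius_equivalence (psi2 P) P (- (r - t)) (- (r ^+ 2 - t)) (1 - r) (r - t)
    (s * delta4 r t ^+ 2).
Proof.
move=> nzd; split=> [||E iota x].
- have -> : - (r - t) * (r - t) - - (r ^+ 2 - t) * (1 - r) = - delta4 r t.
    by rewrite /delta4; ring.
  by rewrite oppr_eq0.
- by rewrite mulf_neq0 ?expf_neq0.
have : iota (delta4 r t) != 0 by rewrite fmorph_eq0.
have : iota s != 0 by rewrite fmorph_eq0.
rewrite /delta4 !(tnth_nth 0) /= !(tnth_nth 0) /=.
rewrite !(fmorphV, rmorphN, rmorphM, rmorphXn, rmorphD, rmorph1, rmorph_nat).
by move=> nzis nzid nzD; apply: sextic_psi2.
Qed.

Lemma psi3_mobius : s * t + 1 != 0 ->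
  mobius_equivalence (psi3 P) P (- r) 0 1 r (r ^+ 3).
Proof.
move=> nzst; split=> [||E iota x].
- by rewrite mul0r subr0 mulNr oppr_eq0 mulf_neq0.
- by rewrite expf_neq0.
have : iota (s * t + 1) != 0 by rewrite fmorph_eq0.
rewrite !(tnth_nth 0) /= !(tnth_nth 0) /=.
rewrite !(fmorphV, rmorphN, rmorphM, rmorphXn, rmorphD, rmorph1, rmorph0) mul1r addr0.
by move=> nzist nzD; apply: sextic_psi3; rewrite ?fmorph_eq0.
Qed.

End PsiEquivalences.

Theorem lemma16 (k : fieldType)
    (char_neq2 : 2%N \notin [pchar k]) (char_neq3 : 3%N \notin [pchar k]) :
  let rst : ratmap k 3 := ratmap_id k 3 in
  [/\ [/\ birational_map (psi0 rst),
          birational_map (psi1 rst),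
          birational_map (psi2 rst)
        & birational_map (psi3 rst)],
      [/\ birationally_equivalent (curve (psi1 rst)) (curve rst),
          birationally_equivalent (curve (psi2 rst)) (curve rst)
        & birationally_equivalent (curve (psi3 rst)) (curve rst)],
      isomorphic_to_group
        (ratmap_gen [:: psi1 rst; psi2 rst; psi3 rst]) PGL2F3
    & isomorphic_to_group
        (ratmap_gen [:: psi0 rst; psi1 rst; psi2 rst; psi3 rst])
        (setX_group [set: 'Z_2]%G PGL2F3)].
Proof.
move=> rst; have two_k : 2 != 0 :> k by move: char_neq2; rewrite inE /=.
have [iso3 iso4] := symmetries_isomorphic two_k; split=> //.
- have [-> -> -> ->] := psi_symmetry two_k.
  have birat g : birational_map (symmetry k g).
    exists (symmetry k g^-1%g); apply: ratmap_inverse_phi.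
    - exact: symmetry_dominant.
    - exact: symmetry1.
    - exact: symmetryM.
  by split; apply: birat.
(* The nonvanishing results at the generic point supply the hypotheses of the three
   substitutions. *)
have [nzr nzs nzt] := generic_coord_neq0 (@rst_generic k).
have [nzst _ nzd] := generic_q_neq0 (@rst_generic k).
rewrite /rst rstE; split.
- exact: mobius_birational (psi1_mobius _ nzr nzt).
- exact: mobius_birational (psi2_mobius nzs nzd).
- exact: mobius_birational (psi3_mobius nzr nzst).
Qed.
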